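(* Let $G$ be the Petersen graph, with vertices $1,\dots,5,1',\dots,5'$ and edges those of the $5$-cycle $(1,2,3,4,5)$, those of the $5$-cycle $(1',4',2',5',3')$, and the edges $ii'$ for $1\le i\le 5$. Then $\mathrm{CUTP}(G)$ has exactly $3614$ facets, in $4$ orbits: (1) an orbit of $2|E|=30$ edge facets; (2) an orbit of $2^4\cdot 12=192$ $5$-cycle facets (from the $12$ $5$-cycles of $G$); (3) an orbit of $2^5\cdot 10=320$ $6$-cycle facets (from the $10$ $6$-cycles of $G$); (4) an orbit of $2^{10}\cdot 3=3072$ facets that are simplices, represented by the facet defined by $$(x_{12}+x_{23}+x_{34}+x_{45}-x_{15})-(x_{4'2'}+x_{5'3'}+x_{3'1'}-x_{1'4'}-x_{2'5'})+2\sum_{i=1}^{5}x_{ii'}\ \ge\ 0 .$$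
   Context: For a graph $G=(V,E)$ and $S\subseteq V$, the cut vector $\delta_S\in\{0,1\}^E$ has $\delta_S(xy)=1$ if and only if exactly one of $x,y$ lies in $S$. The cut polytope $\mathrm{CUTP}(G)\subset\mathbb{R}^E$ is the convex hull of all $\delta_S$, $S\subseteq V$. Switching: for $U\subseteq V$, the affine map $x\mapsto x'$ with $x'(e)=1-x(e)$ if $e$ has exactly one end in $U$ and $x'(e)=x(e)$ otherwise; it maps $\delta_S$ to $\delta_{U\Delta S}$ and so preserves $\mathrm{CUTP}(G)$. Orbits of facets are orbits under the group generated by the switchings and by $\mathrm{Aut}(G)$. Edge facets: facets defined by $x(e)\ge 0$ or its switching $x(e)\le 1$, for $e\in E$. $s$-cycle facets coming from an $s$-cycle $C$ ($s\ge3$) of $G$: facets defined by the $2^{s-1}$ inequalities $\sum_{e\in F}x(e)-\sum_{e\in C\setminus F}x(e)\le |F|-1$ with $F\subseteq C$, $|F|$ odd (these are the switchings of $\sum_{i=1}^{s-1}x(v_iv_{i+1})-x(v_1v_s)\ge 0$ for $C=(v_1,\dots,v_s)$). *)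

(* Defs.v *)
From mathcomp Require Import all_boot all_order all_algebra perm.
From mathcomp Require Import boolp classical_sets functions cardinality.

Set Implicit Arguments.
Unset Strict Implicit.
Unset Printing Implicit Defensive.

Import Order.TTheory GRing.Theory Num.Theory.
Local Open Scope classical_set_scope.
Local Open Scope ring_scope.

Section Polytopes.
Variables (R : realFieldType) (V : lmodType R).
Implicit Types (A P F : set V) (f : V -> R).

Definition conv_hull A : set V :=
  [set x | exists (n : nat) (p : 'I_n -> V) (w : 'I_n -> R),
    [/\ forall i, A (p i), forall i, 0 <= w i,
        \sum_(i < n) w i = 1 & x = \sum_(i < n) w i *: p i]].

Definition aff_independent (n : nat) (p : 'I_n -> V) : Prop :=
  forall c : 'I_n -> R, \sum_(i < n) c i = 0 -> \sum_(i < n) c i *: p i = 0 ->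
  forall i, c i = 0.

(* The maximal number of affinely independent points of A is r; that is,
   dim A = r - 1, with the convention that the empty set has dimension -1. *)
Definition aff_rank A (r : nat) : Prop :=
  (exists p : 'I_r -> V, aff_independent p /\ forall i, A (p i)) /\
  (forall n (p : 'I_n -> V), aff_independent p -> (forall i, A (p i)) ->
     (n <= r)%N).

Definition face_by P f : set V := P `&` [set x | f x = 0].

Definition is_face P F : Prop :=
  exists (l : {linear V -> R^o}) (b : R),
    (forall x, P x -> 0 <= l x + b) /\ F = face_by P (fun x => l x + b).

Definition is_facet P F : Prop :=
  is_face P F /\ exists r, aff_rank P r.+1 /\ aff_rank F r.

Definition facets P : set (set V) := [set F | is_facet P F].

(* The inequality 0 <= f x is valid on P and defines a facet of P. *)
Definition defines_facet P f : Prop :=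
  (forall x, P x -> 0 <= f x) /\ is_facet P (face_by P f).

Definition facets_by P (I : set (V -> R)) : set (set V) :=
  [set F | exists f, [/\ I f, defines_facet P f & F = face_by P f]].

Definition is_simplex F : Prop :=
  exists (n : nat) (p : 'I_n -> V),
    aff_independent p /\ F = conv_hull (range p).

End Polytopes.

Record sgraph (V : finType) := SGraph {
  adj :> rel V;
  adj_sym : symmetric adj;
  adj_irr : irreflexive adj }.

Section CutPolytope.
Variables (V : finType) (G : sgraph V).

Definition is_edge (e : {set V}) : bool :=
  [exists x : V, exists y : V, G x y && (e == [set x; y]%SET)].

Definition edge := {e : {set V} | is_edge e}.

Definition crosses (S : {set V}) (e : edge) : bool :=
  #|(val e :&: S)%SET| == 1%N.

Definition automorphism (s : {perm V}) : Prop :=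
  forall x y, G (s x) (s y) = G x y.

(* The image of an edge under an automorphism; the default value of [insubd]
   is only returned when s does not preserve adjacency. *)
Definition aut_edge (s : {perm V}) (e : edge) : edge := insubd e (s @: val e).

(* The edge set of the closed walk c_0, c_1, .., c_{n-1}, c_0. *)
Definition cycle_edges (c : seq V) : {set edge} :=
  [set e : edge | [exists x : V, (x \in c) && (val e == [set x; next c x]%SET)]]%SET.

Definition is_cycle (s : nat) (C : {set edge}) : bool :=
  (3 <= s)%N &&
  [exists c : s.-tuple V, ucycleb G c && (C == cycle_edges c)].

Definition cycles (s : nat) : {set {set edge}} :=
  [set C : {set edge} | is_cycle s C]%SET.

Variable R : realFieldType.
Local Notation RE := {ffun edge -> R^o}.

Definition cut_vector (S : {set V}) : RE := [ffun e => (crosses S e)%:R].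

Definition cutp : set RE := conv_hull (range cut_vector).

Definition switching (U : {set V}) (x : RE) : RE :=
  [ffun e => if crosses U e then 1 - x e else x e].

(* The pullback along s, i.e. the natural action of s^-1. *)
Definition aut_action (s : {perm V}) (x : RE) : RE :=
  [ffun e => x (aut_edge s e)].

(* The group of transformations generated by the switchings and by Aut(G). *)
Inductive cut_symmetry : (RE -> RE) -> Prop :=
| CutSymId : cut_symmetry id
| CutSymComp g h : cut_symmetry g -> cut_symmetry h -> cut_symmetry (g \o h)
| CutSymInv g h :
    cut_symmetry g -> cancel g h -> cancel h g -> cut_symmetry h
| CutSymSwitching U : cut_symmetry (switching U)
| CutSymAut s : automorphism s -> cut_symmetry (aut_action s).

Definition cut_orbit (F : set RE) : set (set RE) :=
  [set g @` F | g in cut_symmetry].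

Definition facet_orbits : set (set (set RE)) :=
  [set cut_orbit F | F in facets cutp].

(* Inequalities are given as functions f, standing for 0 <= f x. *)
Definition edge_inequalities : set (RE -> R) :=
  [set f | exists e : edge, f = (fun x : RE => x e) \/ f = (fun x : RE => 1 - x e)].

Definition cycle_inequalities (C : {set edge}) : set (RE -> R) :=
  [set f | exists F : {set edge}, [/\ F \subset C, odd #|F| &
    f = fun x : RE => (#|F|%:R - 1)
                 - (\sum_(e in F) x e - \sum_(e in (C :\: F)%SET) x e)]].

Definition edge_facets : set (set RE) := facets_by cutp edge_inequalities.

Definition cycle_facets (s : nat) : set (set RE) :=
  [set F | exists2 C, C \in cycles s &
           facets_by cutp (cycle_inequalities C) F].

(* The coordinate of x at the edge uv, and 0 if uv is not an edge. *)
Definition edge_coord (x : RE) (u v : V) : R :=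
  oapp (fun e : edge => x e) 0 (insub [set u; v]%SET).

End CutPolytope.

Arguments cutp {V} G R _.
Arguments edge_facets {V} G R _.
Arguments cycle_facets {V} G R s _.
Arguments facet_orbits {V} G R _.

(* inl i and inr i are the vertices i+1 and (i+1)'. *)
Definition petersen_vertex : finType := ('I_5 + 'I_5)%type.

Definition consecutive (c : seq nat) (i j : nat) : bool :=
  (next c i == j) || (next c j == i).

Definition petersen_adj (u v : petersen_vertex) : bool :=
  match u, v with
  | inl i, inl j => consecutive [:: 1; 2; 3; 4; 5]%N i.+1 j.+1
  | inr i, inr j => consecutive [:: 1; 4; 2; 5; 3]%N i.+1 j.+1
  | inl i, inr j | inr i, inl j => i == j
  end.

Lemma petersen_sym : symmetric petersen_adj.
Proof. by case=> i [] j //=; rewrite /consecutive 1?orbC // eq_sym. Qed.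

Lemma petersen_irr : irreflexive petersen_adj.
Proof. by case=> -[] [|[|[|[|[|]]]]]. Qed.

Definition petersen : sgraph petersen_vertex :=
  SGraph petersen_sym petersen_irr.

Section PetersenInequality.
Variable R : realFieldType.

Definition petersen_form (x : {ffun edge petersen -> R^o}) : R :=
  let o1 : 'I_5 := @Ordinal 5 0 isT in let o2 : 'I_5 := @Ordinal 5 1 isT in
  let o3 : 'I_5 := @Ordinal 5 2 isT in let o4 : 'I_5 := @Ordinal 5 3 isT in
  let o5 : 'I_5 := @Ordinal 5 4 isT in
  let outer i j := edge_coord x (inl i) (inl j) in
  let inner i j := edge_coord x (inr i) (inr j) in
  (outer o1 o2 + outer o2 o3 + outer o3 o4 + outer o4 o5 - outer o1 o5)
  - (inner o4 o2 + inner o5 o3 + inner o3 o1 - inner o1 o4 - inner o2 o5)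
  + 2 * \sum_(i < 5) edge_coord x (inl i) (inr i).

End PetersenInequality.

(* Main.v *)
(** Replacing x_e by z_e = 1 - x_e on a set N of edges, an inequality valid on the
    cut polytope reads sum_e c_e z_e >= b with c >= 0, and its validity says that
    every member of the class of N modulo cuts has c-weight at least b. Up to
    switchings and automorphisms there are six classes. If c_k > c_i + c_j for the
    edges i, j, k at some vertex, then switching that vertex shows that the face
    lies in the edge facet z_k = 0. Otherwise (c, b) lies in the cone cut out by
    these triangle inequalities and by the matchings of the class, whose extreme
    rays are found by the double description method. Each ray defines a valid
    inequality whose tight cuts lie on a facet of the list; since the tight cuts
    of (c, b) are tight for every ray of which (c, b) is a conic combination, a
    facet of the polytope is equal to a facet of the list. The list consists of the
    orbits of four inequalities, each defining a facet by fifteen affinely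
    independent tight cuts; as equal facets have proportional forms, the facets in
    the list can be counted. *)

From Stdlib Require Import ZArith.
From HB Require Import structures.
Require Import Defs.
From mathcomp Require Import all_boot all_order all_algebra perm.
From mathcomp Require Import ssrZ zify ring.
From mathcomp Require Import boolp classical_sets functions cardinality.

Set Implicit Arguments.
Unset Strict Implicit.
Unset Printing Implicit Defensive.

Import Order.TTheory GRing.Theory Num.Theory.
Local Delimit Scope Z_scope with Z.
Local Open Scope classical_set_scope.
Local Open Scope card_scope.
Local Open Scope ring_scope.

(** * Polyhedral cones *)

(** The obstacle is size: the coefficients of an inequality have 2^15 sign patterns. The cuts form a
    binary space of dimension 9, so switchings leave 2^6 classes of patterns, and the 120
    automorphisms leave six. Inside a class all the weights c_e are nonnegative, so the double
    description can start from the unit vectors of an orthant. The graph being cubic is what makes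
    matchings enough. If a member of the class contains two or three edges at a vertex, then
    switching that vertex replaces two of them by the third edge, or removes all three; by the
    triangle inequalities the weight does not grow, and the number of edges drops. This makes the
    cone small enough to be treated by evaluation. Its outcome is certified by tests: each ray is
    checked against all 512 members of its class. A ray is not asked to define a facet. It is enough
    that its tight cuts lie on a listed facet, because a facet contained in another facet is equal
    to it. *)

Lemma leq_count_in (T : eqType) (p q : pred T) (s : seq T) :
  {in s, forall y, p y -> q y} -> (count p s <= count q s)%N.
Proof.
elim: s => //= y s IH pq; apply: leq_add; last first.
  by apply: IH => w ws; apply: pq; rewrite inE ws orbT.
by have := pq y (mem_head _ _); case: (p y) => // ->.
Qed.

Lemma count_ltn (T : eqType) (p q : pred T) (s : seq T) z :
  {in s, forall y, p y -> q y} -> z \in s -> q z -> ~~ p z ->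
  (count p s < count q s)%N.
Proof.
move=> pq zs qz pz; case/splitPr: zs pq => s1 s2 pq.
rewrite !count_cat /= qz (negbTE pz) add0n add1n addnS ltnS.
by apply: leq_add; apply: leq_count_in => w ws; apply: pq;
  rewrite mem_cat ?inE ws ?orbT.
Qed.

Section Cones.
Variables (R : realFieldType) (n : nat).
Implicit Types (f x r : 'rV[R]_n) (C L : seq 'rV[R]_n).

Definition dotp f x : R := \sum_i f 0 i * x 0 i.

Lemma dotpDr f x y : dotp f (x + y) = dotp f x + dotp f y.
Proof. by rewrite /dotp -big_split; apply: eq_bigr => i _; rewrite mxE mulrDr. Qed.

Lemma dotpZr f t x : dotp f (t *: x) = t * dotp f x.
Proof. by rewrite /dotp mulr_sumr; apply: eq_bigr => i _; rewrite mxE mulrCA. Qed.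

Lemma dotpBr f x y : dotp f (x - y) = dotp f x - dotp f y.
Proof. by rewrite -scaleN1r dotpDr dotpZr mulN1r. Qed.

Lemma dotp0r f : dotp f 0 = 0.
Proof. by rewrite /dotp big1 // => i _; rewrite mxE mulr0. Qed.

Lemma dotp_delta i x : dotp (delta_mx 0 i) x = x 0 i.
Proof.
rewrite /dotp (bigD1 i) //= big1 ?addr0 => [|j /negbTE ji].
  by rewrite mxE !eqxx mul1r.
by rewrite mxE ji andbF mul0r.
Qed.

Definition in_cone C x := forall f, f \in C -> 0 <= dotp f x.

(** For [r] in the cone, this says that [r] lies in the smallest face containing [x]. *)
Definition face_sub C x r := forall f, f \in C -> dotp f x = 0 -> dotp f r = 0.

Inductive conic_comb L : 'rV[R]_n -> Prop :=
| conic_comb0 : conic_comb L 0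
| conic_combD x t r : conic_comb L x -> r \in L -> 0 <= t ->
    conic_comb L (x + t *: r).

Lemma conic_comb_ge0 L f x :
  (forall r, r \in L -> 0 <= dotp f r) -> conic_comb L x -> 0 <= dotp f x.
Proof.
move=> fL; elim=> [|{}x t r _ IH rL t0]; first by rewrite dotp0r.
by rewrite dotpDr dotpZr addr_ge0 // mulr_ge0 // fL.
Qed.

(* The family H of functionals selects a face of the cone spanned by L; the ray
   found lies on it because all terms of x do. *)
Lemma conic_comb_ray L (H : 'rV[R]_n -> Prop) g x :
  (forall f r, H f -> r \in L -> 0 <= dotp f r) ->
  conic_comb L x -> (forall f, H f -> dotp f x = 0) ->
  (0 < dotp g x ->
     exists2 r, r \in L & 0 < dotp g r /\ (forall f, H f -> dotp f r = 0)) /\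
  (x != 0 -> 0 <= dotp g x ->
     exists2 r, r \in L & 0 <= dotp g r /\ (forall f, H f -> dotp f r = 0)).
Proof.
move=> HL; elim=> [|{}x t r xL IH rL t0] Hx.
  by rewrite dotp0r ltxx eqxx; split.
have Hxt f : H f -> dotp f x = 0 /\ t * dotp f r = 0.
  move=> Hf; have := Hx f Hf; rewrite dotpDr dotpZr => /eqP.
  have fx : 0 <= dotp f x by apply: conic_comb_ge0 xL => r' r'L; apply: HL.
  by rewrite paddr_eq0 ?mulr_ge0 ?(HL f r) // => /andP[/eqP-> /eqP->].
have [IH1 IH2] := IH (fun f Hf => (Hxt f Hf).1).
have [t_eq0|t_neq0] := eqVneq t 0; first by rewrite t_eq0 scale0r addr0.
have t_gt0 : 0 < t by rewrite lt0r t_neq0.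
have Hr f : H f -> dotp f r = 0.
  by move=> /Hxt[_ /eqP]; rewrite mulf_eq0 (negbTE t_neq0) => /eqP.
split=> [|xr_neq0]; rewrite dotpDr dotpZr => g_ge.
  have [gr|gr] := ltP 0 (dotp g r); first by exists r.
  apply: IH1; apply: lt_le_trans g_ge _.
  by rewrite gerDl pmulr_rle0.
have [gr|gr] := leP 0 (dotp g r); first by exists r.
(* The last ray is negative for [g] while the whole sum is not, so the shorter combination is
   positive for [g] and the strict half of the induction hypothesis supplies the ray. *)
have gx : 0 < dotp g x.
  apply: lt_le_trans (_ : - (t * dotp g r) <= _); first by rewrite oppr_gt0 pmulr_rlt0.
  by rewrite -subr_ge0 opprK.
by have [r' r'L [/ltW g0 ?]] := IH1 gx; exists r'.
Qed.

(** The ratio test: the largest admissible [t] is the minimum of f(x) / f(r) over the constraints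
    [f] with f(r) > 0, and a minimiser becomes tight. *)
Lemma first_hit C x r : in_cone C x -> in_cone C r ->
  (exists2 f, f \in C & 0 < dotp f r) ->
  exists2 t, 0 <= t & in_cone C (x - t *: r) /\
    exists f, [/\ f \in C, dotp f r != 0 & dotp f (x - t *: r) = 0].
Proof.
move=> Cx Cr [f0 f0C f0r].
have i0P : (index f0 C < size C)%N by rewrite index_mem.
pose P (i : 'I_(size C)) := 0 < dotp (nth 0 C i) r.
pose F (i : 'I_(size C)) := dotp (nth 0 C i) x / dotp (nth 0 C i) r.
have Pi0 : P (Ordinal i0P) by rewrite /P /= nth_index.
case: (Order.TotalTheory.arg_minP F Pi0) => i Pi iP.
have nthC (j : 'I_(size C)) : nth 0 C j \in C by rewrite mem_nth.
exists (F i); first by rewrite divr_ge0 ?Cx ?ltW.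
split=> [f fC|]; last first.
  exists (nth 0 C i); split; rewrite ?nthC ?gt_eqF //.
  by rewrite dotpBr dotpZr divfK ?subrr // gt_eqF.
rewrite dotpBr dotpZr subr_ge0.
have := Cr f fC; rewrite le_eqVlt => /predU1P[<-|fr]; first by rewrite mulr0 Cx.
rewrite -ler_pdivlMr //.
have jP : (index f C < size C)%N by rewrite index_mem.
by have := iP (Ordinal jP); rewrite /P /F /= nth_index //; apply.
Qed.

(** Subtract from [x] as much as possible of a ray of its smallest face. Constraints tight at [x]
    stay tight and a new one becomes tight, so the number of slack constraints drops. The coordinate
    functionals in [C] guarantee that the subtraction meets a constraint. *)
Lemma conic_combP C L :
  (forall i, delta_mx 0 i \in C) ->
  (forall r, r \in L -> in_cone C r /\ r != 0) ->
  (forall x, in_cone C x -> x != 0 -> exists2 r, r \in L & face_sub C x r) ->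
  forall x, in_cone C x -> conic_comb L x.
Proof.
move=> unitC LC cover x.
have [m] := ubnP (count (fun f => dotp f x != 0) C).
elim: m x => // m IH x xm Cx.
have [->|x_neq0] := eqVneq x 0; first exact: conic_comb0.
have [r rL xr] := cover x Cx x_neq0.
have [Cr r_neq0] := LC r rL.
have [i ri] : exists i, r 0 i != 0 by apply/rV0Pn.
have [|t t0 [Cy [f [fC fr fy]]]] := first_hit Cx Cr.
  by exists (delta_mx 0 i) => //; rewrite lt0r dotp_delta ri -dotp_delta Cr.
have -> : x = x - t *: r + t *: r by rewrite subrK.
apply: conic_combD => //; apply: IH => //.
rewrite ltnS in xm; apply: leq_trans xm.
have fx : dotp f x != 0 by apply: contraNN fr => /eqP /(xr f fC) ->.
apply: (count_ltn _ fC); rewrite ?fx ?fy ?eqxx // => g gC.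
by apply: contraNN => /eqP gx; rewrite dotpBr dotpZr gx (xr g gC gx) mulr0 subr0.
Qed.

(** Completeness of one double description step. By [conic_combP] it is enough to find a new ray in
    the smallest face of each nonzero [x]: an old ray on the good side of [a], or, if [x] lies on
    the hyperplane of [a] and only rays strictly on either side are found, a ray joining two of
    them. *)
Lemma conic_comb_step C L L' a :
  (forall i, delta_mx 0 i \in C) ->
  (forall r, r \in L -> in_cone C r) ->
  (forall x, in_cone C x -> conic_comb L x) ->
  (forall r, r \in L' -> in_cone (a :: C) r /\ r != 0) ->
  (forall r, r \in L -> 0 <= dotp a r -> r \in L') ->
  (forall p q, p \in L -> q \in L -> 0 < dotp a p -> dotp a q < 0 ->
     exists2 r, r \in L' & dotp a r = 0 /\
       forall f, f \in C -> dotp f p = 0 -> dotp f q = 0 -> dotp f r = 0) ->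
  forall x, in_cone (a :: C) x -> conic_comb L' x.
Proof.
move=> unitC LC combL L'C keep cross; apply: conic_combP => //.
  by move=> i; rewrite inE unitC orbT.
move=> x aCx x_neq0.
have Cx : in_cone C x by move=> f fC; apply: aCx; rewrite inE fC orbT.
(* Every ray obtained through [ray] lies in the smallest face of the old cone that contains [x]. *)
have ray g := @conic_comb_ray L (fun f => f \in C /\ dotp f x = 0) g x
  (fun f r Hf rL => LC r rL f Hf.1) (combL x Cx) (fun f Hf => Hf.2).
have := aCx a; rewrite mem_head => /(_ isT); rewrite le_eqVlt => /predU1P[ax|ax].
  have [_ /(_ x_neq0)] := ray a; rewrite -ax lexx => /(_ isT)[p pL [ap px]].
  have p0 : dotp a p = 0 -> exists2 r, r \in L' & face_sub (a :: C) x r.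
    move=> ap0; exists p; first exact: keep.
    by move=> f; rewrite inE => /predU1P[->//|fC fx]; apply: px.
  have [/p0//|ap_neq0] := eqVneq (dotp a p) 0.
  have ap_gt0 : 0 < dotp a p by rewrite lt0r ap_neq0.
  have dotpN y : dotp (- a) y = - dotp a y.
    by rewrite /dotp -sumrN; apply: eq_bigr => i _; rewrite mxE mulNr.
  have [_ /(_ x_neq0)] := ray (- a).
  rewrite dotpN -ax oppr0 lexx => /(_ isT)[q qL [aq qx]].
  move: aq; rewrite dotpN oppr_ge0 le_eqVlt => /predU1P[aq0|aq].
    exists q; first by rewrite keep ?aq0.
    by move=> f; rewrite inE => /predU1P[->//|fC fx]; apply: qx.
  have [r rL' [ar rpq]] := cross p q pL qL ap_gt0 aq.
  exists r => // f; rewrite inE => /predU1P[->//|fC fx].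
  by apply: rpq => //; [apply: px|apply: qx].
have [/(_ ax)[r rL [ar rx]] _] := ray a.
exists r; first by rewrite keep ?ltW.
move=> f; rewrite inE => /predU1P[-> ax0|fC fx]; last by apply: rx.
by rewrite ax0 ltxx in ax.
Qed.

End Cones.

(** * The double description method over the integers *)

Section IntegerCones.
Variables (R : realFieldType) (n : nat).

(** All computations take place in binary integers; [zr] transports their results to an arbitrary
    ordered field. *)
Definition zr (z : Z) : R := (int_of_Z z)%:~R.

Lemma zr0 : zr 0%Z = 0. Proof. by []. Qed.
Lemma zr1 : zr 1%Z = 1. Proof. by []. Qed.
Lemma zrD x y : zr (x + y)%Z = zr x + zr y.
Proof. by rewrite /zr (rmorphD int_of_Z) rmorphD. Qed.
Lemma zrM x y : zr (x * y)%Z = zr x * zr y.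
Proof. by rewrite /zr (rmorphM int_of_Z) rmorphM. Qed.
Lemma zrN x : zr (- x)%Z = - zr x.
Proof. by rewrite /zr (rmorphN int_of_Z) rmorphN. Qed.
Lemma zrB x y : zr (x - y)%Z = zr x - zr y.
Proof. by rewrite -Z.add_opp_r zrD zrN. Qed.
Lemma zr_ge0 x : (0 <= zr x) = (0 <=? x)%Z.
Proof. by rewrite /zr ler0z; lia. Qed.
Lemma zr_gt0 x : (0 < zr x) = (0 <? x)%Z.
Proof. by rewrite /zr ltr0z; lia. Qed.
Lemma zr_eq0 x : (zr x == 0) = (x =? 0)%Z.
Proof. by rewrite /zr intr_eq0; lia. Qed.

Definition zv (a : seq Z) : 'rV[R]_n := \row_i zr (nth 0%Z a i).

Fixpoint dotz (a b : seq Z) : Z :=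
  match a, b with
  | x :: a', y :: b' => (x * y + dotz a' b')%Z
  | _, _ => 0%Z
  end.

Lemma dotz_sum m (a b : seq Z) : (size a <= m)%N ->
  \sum_(i < m) zr (nth 0%Z a i) * zr (nth 0%Z b i) = zr (dotz a b).
Proof.
elim: m a b => [|m IH] [|x a] [|y b] //= am; rewrite ?big_ord0 ?big_ord_recl //=.
- by rewrite big1 ?mul0r ?addr0 // => i _; rewrite mul0r.
- by rewrite big1 ?mul0r ?addr0 // => i _; rewrite ?nth_nil mul0r.
- by rewrite big1 ?mulr0 ?addr0 // => i _; rewrite ?nth_nil mulr0.
- by rewrite zrD zrM -IH.
Qed.

Lemma dotp_zv a b : (size a <= n)%N -> dotp (zv a) (zv b) = zr (dotz a b).
Proof. by move=> an; rewrite -(dotz_sum b an); apply: eq_bigr => i _; rewrite !mxE. Qed.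

(** Inclusion of sets of tight constraints. The nested [if]s short-circuit under call-by-value
    evaluation, where both arguments of [&&] would be computed. *)
Fixpoint mask_sub (m1 m2 : seq bool) : bool :=
  match m1, m2 with
  | b1 :: m1', b2 :: m2' =>
      if b1 then if b2 then mask_sub m1' m2' else false else mask_sub m1' m2'
  | _, _ => true
  end.

Fixpoint mask_and (m1 m2 : seq bool) : seq bool :=
  match m1, m2 with
  | b1 :: m1', b2 :: m2' => (if b1 then b2 else false) :: mask_and m1' m2'
  | _, _ => [::]
  end.

Definition mask (C : seq (seq Z)) v := [seq (dotz f v =? 0)%Z | f <- C].

Lemma mask_subP C p q r : mask_sub (mask_and (mask C p) (mask C q)) (mask C r) ->
  forall f, f \in C -> dotz f p = 0%Z -> dotz f q = 0%Z -> dotz f r = 0%Z.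
Proof.
elim: C => //= g C IH sub f; rewrite inE => /predU1P[->|fC] fp fq.
  by move: sub; rewrite fp fq /=; case: Z.eqb_spec.
by apply: IH => //; move: sub; do 3!case: Z.eqb_spec => //.
Qed.

Definition ray := (seq Z * seq bool)%type.

(** With d = a.p > 0 and e = a.q < 0, the vector dq - ep is a nonnegative combination lying on the
    hyperplane of [a]; dividing by the gcd keeps the entries small. Its properties are tested in
    [cross] on each vector produced. *)
Definition combine (d e : Z) (p q : seq Z) : seq Z :=
  let v := [seq (d * xy.2 - e * xy.1)%Z | xy <- zip p q] in
  let g := foldr Z.gcd 0%Z v in [seq (x / g)%Z | x <- v].

(* The ray combining p and q is dropped as soon as a ray already found lies on
   every facet of the cone containing both p and q. *)
Definition cross a C (acc : option (seq ray)) (pq : (ray * Z) * (ray * Z)) :=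
  if acc is Some Zs then
    let: ((p, d), (q, e)) := pq in
    let m := mask_and p.2 q.2 in
    if has (fun r : ray => mask_sub m r.2) Zs then acc else
    let v := combine d e p.1 q.1 in
    let ds := [seq dotz f v | f <- C] in
    let m' := [seq (x =? 0)%Z | x <- ds] in
    if [&& all (fun x => 0 <=? x)%Z ds, mask_sub m m', (dotz a v =? 0)%Z,
           has (fun x => ~~ (x =? 0)%Z) v & (size v <= n)%N]
    then Some ((v, m') :: Zs) else None
  else None.

Definition cone_step (C : seq (seq Z)) (L : seq ray) (a : seq Z) : option (seq ray) :=
  let D := [seq (r, dotz a r.1) | r <- L] in
  let pos := [seq rd <- D | (0 <? rd.2)%Z] in
  let neg := [seq rd <- D | (rd.2 <? 0)%Z] in
  let zero := [seq rd.1 | rd <- D & (rd.2 =? 0)%Z] in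
  if foldl (cross a C) (Some zero) [seq (p, q) | p <- pos, q <- neg] is Some Zs
  then Some ([seq (r.1, true :: r.2) | r <- Zs]
             ++ [seq (rd.1.1, false :: rd.1.2) | rd <- pos])
  else None.

Fixpoint cone_rays (C : seq (seq Z)) (L : seq ray) (A : seq (seq Z)) :=
  if A is a :: A' then
    if cone_step C L a is Some L' then cone_rays (a :: C) L' A' else None
  else Some L.

Definition ray_ok C (r : ray) :=
  [/\ r.2 = mask C r.1, in_cone (map zv C) (zv r.1) & zv r.1 != 0].

(** The invariant of the method: the first clause is soundness of the rays with their stored masks,
    the last one completeness. *)
Definition rays_of C (L : seq ray) :=
  [/\ {in L, forall r, ray_ok C r}, all (fun a : seq Z => size a <= n)%N C,
      forall i, delta_mx 0 i \in map zv C &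
      forall x, in_cone (map zv C) x -> conic_comb [seq zv r.1 | r <- L] x].

Lemma in_coneP C v : all (fun a : seq Z => size a <= n)%N C ->
  (in_cone (map zv C) (zv v) <-> all (fun a => 0 <=? dotz a v)%Z C).
Proof.
move=> /allP Cn; split=> [H|/allP H _ /mapP[a aC ->]].
  by apply/allP => a aC; rewrite -zr_ge0 -dotp_zv ?Cn // H ?map_f.
by rewrite dotp_zv ?Cn // zr_ge0 H.
Qed.

Lemma zv_neq0 v : has (fun x => ~~ (x =? 0)%Z) v -> (size v <= n)%N -> zv v != 0.
Proof.
move=> /(has_nthP 0%Z)[i iv vi] vn; apply/rV0Pn.
by exists (Ordinal (leq_trans iv vn)); rewrite mxE zr_eq0.
Qed.

Lemma foldl_crossP a C ps Z0 Zs : all (fun a : seq Z => size a <= n)%N C ->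
  let good := fun r : ray => ray_ok C r /\ dotz a r.1 = 0%Z in
  (forall pq, pq \in ps -> pq.1.1.2 = mask C pq.1.1.1 /\ pq.2.1.2 = mask C pq.2.1.1) ->
  foldl (cross a C) (Some Z0) ps = Some Zs ->
  {in Z0, forall r, good r} ->
  [/\ {in Zs, forall r, good r}, {subset Z0 <= Zs} &
      forall pq, pq \in ps -> exists2 r, r \in Zs &
        forall f, f \in C -> dotz f pq.1.1.1 = 0%Z -> dotz f pq.2.1.1 = 0%Z ->
          dotz f r.1 = 0%Z].
Proof.
move=> Cn good; elim: ps Z0 => [|[[p d] [q e]] ps IH] Z0 psm /=.
  by case=> -> HZ; split.
have /= [pm qm] := psm _ (mem_head _ _).
have {}psm pq : pq \in ps -> pq.1.1.2 = mask C pq.1.1.1 /\ pq.2.1.2 = mask C pq.2.1.1.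
  by move=> pqs; apply: psm; rewrite inE pqs orbT.
(* Treats at once a pair covered by an earlier ray, where [Z1] is [Z0], and a pair for which a new
   ray is added. *)
have step Z1 r : r \in Z1 -> {subset Z0 <= Z1} -> {in Z1, forall r, good r} ->
    mask_sub (mask_and p.2 q.2) r.2 ->
    foldl (cross a C) (Some Z1) ps = Some Zs ->
    [/\ {in Zs, forall r, good r}, {subset Z0 <= Zs} &
      forall pq, pq \in (p, d, (q, e)) :: ps -> exists2 r, r \in Zs &
        forall f, f \in C -> dotz f pq.1.1.1 = 0%Z -> dotz f pq.2.1.1 = 0%Z ->
          dotz f r.1 = 0%Z].
  move=> rZ1 Z01 HZ1 pqr /(IH _ psm)/(_ HZ1)[HZs Z1s cov]; split=> //.
    by move=> z /Z01/Z1s.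
  move=> pq; rewrite inE => /predU1P[->|/cov//]; exists r; first exact: Z1s.
  apply: mask_subP; have [[<- _ _] _] := HZ1 r rZ1.
  by rewrite /= -pm -qm.
case: hasP => [[r rZ pqr]|_] foldE HZ0; first exact: (step Z0 r).
move: foldE; case: ifP => [|_]; last first.
  have foldN : foldl (cross a C) None ps = None by elim: (ps).
  by rewrite foldN.
set v := combine _ _ _ _ => /and5P[/allP v_ge0 sub /Z.eqb_eq av v_neq0 vn].
rewrite -map_comp in sub *; apply: (step _ (v, mask C v)) => //.
- by rewrite mem_head.
- by move=> z; rewrite inE orbC => ->.
- move=> z; rewrite inE => /predU1P[->|/HZ0//]; split=> //; split=> //=.
    by apply/in_coneP => //; apply/allP => f fC; apply/v_ge0/map_f.
  exact: zv_neq0.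
Qed.

Lemma cone_stepP C L a L' : (size a <= n)%N ->
  rays_of C L -> cone_step C L a = Some L' -> rays_of (a :: C) L'.
Proof.
move=> an [Lok Cn unitC combL]; rewrite /cone_step.
set D := [seq (r, dotz a r.1) | r <- L].
set pos := [seq rd <- D | (0 <? rd.2)%Z]; set neg := [seq rd <- D | (rd.2 <? 0)%Z].
set zero := [seq rd.1 | rd <- D & _].
have DP rd : rd \in D -> rd.1 \in L /\ rd.2 = dotz a rd.1.1.
  by case/mapP=> r rL ->.
case E: foldl => [Zs|//] [<-].
have /= := foldl_crossP Cn _ E.
case=> [pq /allpairsP[[p q] [/= + + ->]]|r|Zok zeroZ cov].
- rewrite !mem_filter => /andP[_ /DP[pL _]] /andP[_ /DP[qL _]].
  by split; [case: (Lok _ pL)|case: (Lok _ qL)].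
- case/mapP=> rd; rewrite mem_filter => /andP[/Z.eqb_eq rd0 /DP[rL rE]] ->.
  by split; [apply: Lok|rewrite -rE].
set Lz := map _ Zs; set Lp := map _ pos.
have Lz_ok r : r \in Lz -> ray_ok (a :: C) r.
  case/mapP=> z /Zok[[zm zC z0] az] ->; split; rewrite //= ?az ?zm //.
  move=> f; rewrite inE => /predU1P[->|/zC//].
  by rewrite dotp_zv // az.
have Lp_ok r : r \in Lp -> ray_ok (a :: C) r.
  case/mapP=> rd; rewrite mem_filter => /andP[ar /DP[/Lok[rm rC r0] rE]] ->.
  rewrite rE in ar; split; rewrite //= ?rm ?ar //.
    by case: Z.eqb_spec ar => //= ->.
  move=> f; rewrite inE => /predU1P[->|/rC//].
  by rewrite dotp_zv // zr_ge0; move: ar => /=; lia.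
have L'ok : {in Lz ++ Lp, forall r, ray_ok (a :: C) r}.
  by move=> r; rewrite mem_cat => /orP[/Lz_ok|/Lp_ok].
split=> //=; first by rewrite an.
  by move=> i; rewrite inE unitC orbT.
apply: (conic_comb_step unitC (L := [seq zv r.1 | r <- L])) => //.
- by move=> _ /mapP[r /Lok[_ rC _] ->].
- by move=> _ /mapP[r /L'ok[_ rC r0] ->].
- move=> _ /mapP[r rL ->]; rewrite dotp_zv // zr_ge0 => ar.
  have rD : (r, dotz a r.1) \in D by apply/mapP; exists r.
  rewrite map_cat mem_cat; have [ar0|ar0] := Z.eqb_spec (dotz a r.1) 0%Z.
    apply/orP; left; apply/mapP; exists (r.1, true :: r.2) => //.
    apply: (map_f (fun r : ray => (r.1, true :: r.2))); apply: zeroZ; apply/mapP.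
    by exists (r, dotz a r.1) => //; rewrite mem_filter rD /= ar0.
  apply/orP; right; apply/mapP; exists (r.1, false :: r.2) => //.
  apply/mapP; exists (r, dotz a r.1) => //.
  by rewrite mem_filter rD andbT; move: ar ar0 => /=; lia.
- move=> _ _ /mapP[p pL ->] /mapP[q qL ->].
  rewrite !dotp_zv // zr_gt0 -oppr_gt0 -zrN zr_gt0 => ap aq.
  have [|r rZ pqr] := cov ((p, dotz a p.1), (q, dotz a q.1)).
    apply/allpairsP; exists ((p, dotz a p.1), (q, dotz a q.1)); split=> //=.
      by rewrite mem_filter /= ap; apply/mapP; exists p.
    by rewrite mem_filter /=; apply/andP; split; [move: aq => /=; lia|apply/mapP; exists q].
  exists (zv r.1).
    rewrite map_cat mem_cat; apply/orP; left; apply/mapP.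
    exists (r.1, true :: r.2) => //.
    exact: (map_f (fun r : ray => (r.1, true :: r.2))).
  split=> [|_ /mapP[f fC ->]]; first by rewrite dotp_zv // (Zok r rZ).2.
  rewrite !dotp_zv ?(allP Cn) // => /eqP; rewrite zr_eq0 => /Z.eqb_eq fp /eqP.
  by rewrite zr_eq0 => /Z.eqb_eq fq; rewrite (pqr f fC).
Qed.

Lemma cone_raysP C L A L' : all (fun a : seq Z => size a <= n)%N A ->
  rays_of C L -> cone_rays C L A = Some L' -> rays_of (rev A ++ C) L'.
Proof.
elim: A C L => [|a A IH] C L /=; first by move=> _ CL [<-].
case/andP=> an An CL; case E: cone_step => [L1|//].
move=> /(IH _ _ An (cone_stepP an CL E)).
by rewrite rev_cons cat_rcons.
Qed.

Definition unit_vectors : seq (seq Z) :=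
  [seq [seq if i == j then 1%Z else 0%Z | j <- iota 0 n] | i <- iota 0 n].

Definition orthant_rays : seq ray := [seq (v, mask unit_vectors v) | v <- unit_vectors].

Lemma zv_unit (i : 'I_n) :
  zv [seq if i == j :> nat then 1%Z else 0%Z | j <- iota 0 n] = delta_mx 0 i.
Proof.
apply/rowP => j; rewrite !mxE eqxx (nth_map 0%N) ?size_iota // nth_iota // add0n.
by rewrite -val_eqE eq_sym; case: eqP.
Qed.

Lemma rays_of_orthant : rays_of unit_vectors orthant_rays.
Proof.
have unitP v : v \in unit_vectors -> exists i, zv v = delta_mx 0 i.
  case/mapP=> i; rewrite mem_iota /= add0n => i_n ->.
  by exists (Ordinal i_n); rewrite -zv_unit.
have unit_mem i : delta_mx 0 i \in map zv unit_vectors.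
  by rewrite -zv_unit; do 2!apply: map_f; rewrite mem_iota /=.
have unit_size : all (fun a : seq Z => size a <= n)%N unit_vectors.
  by apply/allP=> _ /mapP[i _ ->]; rewrite size_map size_iota.
have delta_cone i : in_cone (map zv unit_vectors) (delta_mx 0 i).
  move=> _ /mapP[v /unitP[j vE] ->]; rewrite vE dotp_delta mxE.
  by case: eqP => _ //=; case: eqP.
have delta_neq0 i : delta_mx 0 i != 0 :> 'rV[R]_n.
  by apply/rV0Pn; exists i; rewrite mxE !eqxx oner_eq0.
have raysE : [seq zv r.1 | r <- orthant_rays] = map zv unit_vectors.
  by rewrite -map_comp.
split=> //.
  move=> _ /mapP[v /unitP[i vi] ->]; split=> //=; rewrite vi //.
rewrite raysE; apply: conic_combP => //.
  by move=> _ /mapP[v /unitP[i ->] ->].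
(* A coordinate that vanishes at [x] is not the [i]-th, so it vanishes at the [i]-th unit vector
   too. *)
move=> x _ /rV0Pn[i xi]; exists (delta_mx 0 i) => //.
move=> _ /mapP[v /unitP[j ->] ->]; rewrite !dotp_delta mxE => xj.
by case: eqP => _ //=; case: eqP => // ji; rewrite -ji xj eqxx in xi.
Qed.

Theorem conic_comb_cone_rays A L : all (fun a : seq Z => size a <= n)%N A ->
  cone_rays unit_vectors orthant_rays A = Some L ->
  forall x : 'rV[R]_n, (forall i, 0 <= x 0 i) ->
    (forall a, a \in A -> 0 <= dotp (zv a) x) ->
    conic_comb [seq zv r.1 | r <- L] x.
Proof.
move=> An AL x x_ge0 Ax.
have [_ _ _] := cone_raysP An rays_of_orthant AL; apply.
move=> _ /mapP[a + ->]; rewrite mem_cat mem_rev => /orP[/Ax//|].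
case/mapP=> i; rewrite mem_iota /= add0n => i_n ->.
by rewrite (zv_unit (Ordinal i_n)) dotp_delta.
Qed.

End IntegerCones.

(** * Affine forms and facets *)

Section Forms.
Variables (R : realFieldType) (E : finType).
Local Notation RE := {ffun E -> R^o}.
Implicit Types (x y : RE) (w : E -> R) (A P F : set RE).

Definition linear_form w x : R^o := \sum_e w e * x e.

Lemma linear_form_is_linear w : linear (linear_form w).
Proof.
move=> a x y; rewrite /linear_form /GRing.scale /= mulr_sumr -big_split /=.
by apply: eq_bigr => e _; rewrite !ffunE mulrDr mulrCA.
Qed.

HB.instance Definition _ w :=
  GRing.isLinear.Build R RE R^o *:%R (linear_form w) (linear_form_is_linear w).

Definition affine_form w (b : R) x : R := linear_form w x + b.

Lemma linearE (l : {linear RE -> R^o}) :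
  exists w, forall x, l x = linear_form w x.
Proof.
exists (fun e => l [ffun e' => (e' == e)%:R]) => x.
have {1}-> : x = \sum_e x e *: [ffun e' => (e' == e)%:R].
  apply/ffunP => e; rewrite sum_ffunE (bigD1 e) //= big1 => [|e' /negbTE ne].
    by rewrite !ffunE eqxx addr0 /GRing.scale /= mulr1.
  by rewrite !ffunE eq_sym ne /GRing.scale /= mulr0.
by rewrite linear_sum; apply: eq_bigr => e _; rewrite linearZ /= /GRing.scale /= mulrC.
Qed.

Lemma is_faceP P F : is_face P F <->
  exists w b, (forall x, P x -> 0 <= affine_form w b x) /\
              F = face_by P (affine_form w b).
Proof.
split=> [[l [b [Pl ->]]]|[w [b [Pw ->]]]]; last by exists (linear_form w), b.
have [w lw] := linearE l; exists w, b.
have eq x : l x + b = affine_form w b x by rewrite /affine_form lw.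
split=> [x Px|]; first by rewrite -eq; apply: Pl.
by congr (face_by _ _); apply/funext.
Qed.

(** The correction term allows any sum of coefficients: sum 1 serves convex and affine combinations,
    sum 0 serves affine dependences. *)
Lemma affine_form_comb w b n (c : 'I_n -> R) (p : 'I_n -> RE) :
  affine_form w b (\sum_i c i *: p i) =
    \sum_i c i * affine_form w b (p i) + (1 - \sum_i c i) * b.
Proof.
rewrite /affine_form linear_sum /=.
under eq_bigr do rewrite linearZ.
under [in RHS]eq_bigr do rewrite mulrDr.
by rewrite big_split /= mulrBl mul1r -mulr_suml -addrA [X in _ = _ + X]addrC subrK.
Qed.

Lemma conv_hull_ge0 A w b : (forall x, A x -> 0 <= affine_form w b x) ->
  forall x, conv_hull A x -> 0 <= affine_form w b x.
Proof.
move=> Ab _ [n [p [c [Ap c0 c1 ->]]]].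
rewrite affine_form_comb c1 subrr mul0r addr0 sumr_ge0 // => i _.
by rewrite mulr_ge0 ?Ab.
Qed.

Lemma sub_conv_hull A : A `<=` conv_hull A.
Proof.
move=> x Ax; exists 1%N, (fun=> x), (fun=> 1); split=> //.
  by rewrite big_ord1.
by rewrite big_ord1 scale1r.
Qed.

(** A zero sum of nonnegative terms has only zero terms, so a tight point of the hull is a
    combination of tight points of [A]. Inclusions between faces are thus decided on cuts. *)
Lemma conv_hull_vanish A w b w' b' :
  (forall x, A x -> 0 <= affine_form w b x) ->
  (forall x, A x -> affine_form w b x = 0 -> affine_form w' b' x = 0) ->
  forall x, conv_hull A x -> affine_form w b x = 0 -> affine_form w' b' x = 0.
Proof.
move=> Ab Abb' _ [n [p [c [Ap c0 c1 ->]]]].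
rewrite !affine_form_comb c1 subrr !mul0r !addr0 => /eqP.
rewrite psumr_eq0 => [/allP cp0|i _]; last by rewrite mulr_ge0 ?Ab.
apply: big1 => i _; have := cp0 i (mem_index_enum i).
rewrite /= mulf_eq0 => /orP[/eqP->|/eqP pi0]; first by rewrite mul0r.
by rewrite Abb' ?mulr0.
Qed.

Lemma face_conv_hull A w b : (forall x, A x -> 0 <= affine_form w b x) ->
  face_by (conv_hull A) (affine_form w b) =
  conv_hull (A `&` [set x | affine_form w b x = 0]).
Proof.
move=> Ab; apply/seteqP; split=> [x [[n [p [c [Ap c0 c1 xE]]]] fx]|x]; last first.
  case=> n [p [c [Ap c0 c1 ->]]]; split.
    by exists n, p, c; split=> // i; case: (Ap i).
  rewrite /= affine_form_comb c1 subrr mul0r addr0 big1 // => i _.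
  by case: (Ap i) => _ /= ->; rewrite mulr0.
have cp0 i : c i * affine_form w b (p i) = 0.
  have /eqP := fx; rewrite xE affine_form_comb c1 subrr mul0r addr0.
  rewrite psumr_eq0 => [/allP/(_ i (mem_index_enum i))/eqP//|j _].
  by rewrite mulr_ge0 ?Ab.
have [j cj] : exists j, c j != 0.
  apply/existsP; rewrite -negb_forall; apply/negP => /forallP c_eq0.
  by move: c1; rewrite big1 => [/eqP|i _]; [rewrite eq_sym oner_eq0|apply/eqP].
have pj0 : affine_form w b (p j) = 0.
  by have /eqP := cp0 j; rewrite mulf_eq0 (negbTE cj) => /eqP.
(* Points of weight zero may fail to be tight; they are replaced by the tight point [p j]. *)
exists n, (fun i => if c i == 0 then p j else p i), c; split=> // [i|].
  case: eqP => [_|/eqP ci]; first by split; [apply: Ap|].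
  by split; [apply: Ap|have /eqP := cp0 i; rewrite mulf_eq0 (negbTE ci) => /eqP].
rewrite xE; apply: eq_bigr => i _; case: eqP => [->|//].
by rewrite !scale0r.
Qed.

(** Appending a coordinate 1 turns affine independence into linear independence of rows, so that
    matrix rank applies. *)
Definition homog x : 'rV[R]_(#|E| + 1) :=
  row_mx (\row_i x (enum_val i)) (const_mx 1).

Lemma homog_comb n (c : 'I_n -> R) (p : 'I_n -> RE) :
  \sum_i c i *: homog (p i) =
    row_mx (\row_j (\sum_i c i *: p i) (enum_val j)) (const_mx (\sum_i c i)).
Proof.
apply/rowP => j; rewrite summxE mxE; under eq_bigr do rewrite 2!mxE.
case: (fintype.split j) => k; rewrite !mxE ?sum_ffunE; apply: eq_bigr => i _.
  by rewrite ?mxE ?ffunE.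
by rewrite ?mxE mulr1.
Qed.

End Forms.

(** * Facets: dimension, maximality, uniqueness of the defining form *)

Section Facets.
Variables (R : realFieldType) (E : finType).
Local Notation RE := {ffun E -> R^o}.
Implicit Types (x y q : RE) (w : E -> R) (A P F : set RE).

Lemma aff_independentP n (p : 'I_n -> RE) :
  aff_independent p <-> row_free (\matrix_(i < n) homog (p i)).
Proof.
split=> [pI|pI c c0 cp0].
  apply: inj_row_free => v; rewrite mulmx_sum_row => v0.
  have [cp c0] : (\row_j (\sum_i v 0 i *: p i) (enum_val j) = 0 :> 'rV[R]_#|E|) /\
            (const_mx (\sum_i v 0 i) = 0 :> 'rV[R]_1).
    apply: eq_row_mx; rewrite row_mx0 -homog_comb -[RHS]v0.
    by apply: eq_bigr => i _; rewrite rowK.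
  apply/rowP => i; rewrite mxE; apply: pI => [|{i}].
    by move/rowP/(_ ord0): c0; rewrite !mxE.
  apply/ffunP => e; move/rowP/(_ (enum_rank e)): cp.
  by rewrite !mxE enum_rankK => ->; rewrite ffunE.
have : \row_i c i *m \matrix_(i < n) homog (p i) = 0.
  rewrite mulmx_sum_row; under eq_bigr do rewrite rowK mxE.
  rewrite homog_comb cp0 c0; apply/rowP => j; rewrite !mxE.
  by case: (fintype.split j) => k; rewrite !mxE ?ffunE.
rewrite -[X in _ = X](mul0mx _ (\matrix_(i < n) homog (p i))).
by move=> /(row_free_inj pI)/rowP ci i; have := ci i; rewrite !mxE.
Qed.

Lemma aff_independent_leq n (p : 'I_n -> RE) : aff_independent p -> (n <= #|E|.+1)%N.
Proof.
move=> /aff_independentP; rewrite -row_leq_rank => /leq_trans; apply.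
by rewrite (leq_trans (rank_leq_col _)) ?addn1.
Qed.

Lemma aff_independent_span (p : 'I_#|E|.+1 -> RE) : aff_independent p ->
  forall x, exists2 c : 'I_#|E|.+1 -> R, \sum_i c i = 1 & x = \sum_i c i *: p i.
Proof.
move=> /aff_independentP pI x.
have full : row_full (\matrix_(i < #|E|.+1) homog (p i)).
  by rewrite /row_full (eqP pI) addn1.
have /submxP[v vE] := submx_full (homog x) full.
move: vE; rewrite mulmx_sum_row; under eq_bigr do rewrite rowK.
rewrite homog_comb => /eq_row_mx[xE c1]; exists (fun i => v 0 i).
  by move/rowP/(_ ord0): c1; rewrite !mxE.
apply/ffunP => e; move/rowP/(_ (enum_rank e)): xE.
by rewrite !mxE enum_rankK.
Qed.

Definition add_point n (p : 'I_n -> RE) q (i : 'I_n.+1) : RE :=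
  if unlift ord0 i is Some j then p j else q.

(** Applied to an affine dependence, the form leaves only the term of [q], whose coefficient must
    therefore vanish. *)
Lemma aff_independent_add w b n (p : 'I_n -> RE) q :
  aff_independent p -> (forall i, affine_form w b (p i) = 0) ->
  affine_form w b q != 0 -> aff_independent (add_point p q).
Proof.
move=> pI fp fq c c0 cp0; have := affine_form_comb w b c (add_point p q).
have p0 : add_point p q ord0 = q by rewrite /add_point unlift_none.
have pS i : add_point p q (lift ord0 i) = p i by rewrite /add_point liftK.
rewrite cp0 c0 subr0 mul1r big_ord_recl p0 big1 ?addr0 => [|i _]; last first.
  by rewrite pS fp mulr0.
rewrite /affine_form linear0 add0r -[X in X = _]add0r => /addIr/esym/eqP.
rewrite mulf_eq0 (negbTE fq) orbF => /eqP c00.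
move: c0 cp0; rewrite !big_ord_recl c00 scale0r !add0r => c0 cp0.
move=> i; case: (unliftP ord0 i) => [j ->|-> //].
apply: (pI (fun j => c (lift ord0 j))) => //.
by rewrite -[RHS]cp0; apply: eq_bigr => k _; rewrite pS.
Qed.

Definition full_dim P := exists p : 'I_#|E|.+1 -> RE, aff_independent p /\ forall i, P (p i).

Lemma add_pointP P n (p : 'I_n -> RE) q :
  (forall i, P (p i)) -> P q -> forall i, P (add_point p q i).
Proof. by move=> Pp Pq i; rewrite /add_point; case: unlift. Qed.

(** Adding [q] to the tight points gives #|E|+1 independent points of [P], the maximum. The face
    cannot hold that many, as adding [q] once more would exceed the maximum. *)
Lemma is_facetI P w b (p : 'I_#|E| -> RE) q :
  (forall x, P x -> 0 <= affine_form w b x) ->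
  aff_independent p -> (forall i, P (p i)) -> (forall i, affine_form w b (p i) = 0) ->
  P q -> affine_form w b q != 0 ->
  is_facet P (face_by P (affine_form w b)) /\ full_dim P.
Proof.
move=> Pf pI Pp fp Pq fq.
have pqI := aff_independent_add pI fp fq; have Ppq := add_pointP Pp Pq.
split; last by exists (add_point p q).
split; first by apply/is_faceP; exists w, b.
exists #|E|; split; split.
- by exists (add_point p q).
- by move=> n p' /aff_independent_leq.
- by exists p; split=> // i; split=> //; apply: fp.
move=> n p' p'I Fp'; rewrite -ltnS.
by apply: aff_independent_leq (aff_independent_add p'I (fun i => (Fp' i).2) fq).
Qed.

Lemma facet_points P F : full_dim P -> is_facet P F ->
  exists p : 'I_#|E| -> RE, aff_independent p /\ forall i, F (p i).
Proof.
move=> [p [pI Pp]] [_ [r [[[p1 [p1I _]] Pmax] [Fp _]]]].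
have rE : r = #|E|.
  by apply/eqP; rewrite eqn_leq -ltnS (aff_independent_leq p1I) -ltnS (Pmax _ p).
by rewrite rE in Fp.
Qed.

(** The points of a facet together with one point [q] off it affinely span the space, and both forms
    vanish on the facet, so their values at [q] fix the ratio. *)
Lemma facet_form_unique P F w b w' b' q : full_dim P -> is_facet P F ->
  (forall x, F x -> affine_form w b x = 0) ->
  (forall x, F x -> affine_form w' b' x = 0) ->
  affine_form w b q != 0 ->
  forall x, affine_form w' b' x =
    affine_form w' b' q / affine_form w b q * affine_form w b x.
Proof.
move=> fullP facetF Fw Fw' fq x; have [p [pI Fp]] := facet_points fullP facetF.
have fp i := Fw _ (Fp i).
have [c c1 ->] := aff_independent_span (aff_independent_add pI fp fq) x.
rewrite !affine_form_comb c1 subrr !mul0r !addr0 mulr_sumr; apply: eq_bigr => i _.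
rewrite /add_point; case: (unlift ord0 i) => [j|]; last by rewrite mulrCA divfK.
by rewrite fp Fw' ?mulr0.
Qed.

Lemma facet_nonzero P F w b : full_dim P -> is_facet P F -> F = face_by P (affine_form w b) ->
  exists2 q, P q & affine_form w b q != 0.
Proof.
move=> fullP facetF FE; apply: contrapT => noq.
have f0 q : P q -> affine_form w b q = 0.
  by move=> Pq; apply: contrapT => /eqP fq; apply: noq; exists q.
have [_ [r [[[p [pI Pp]] _] [_ Fmax]]]] := facetF.
have := Fmax _ p pI; rewrite ltnn FE => /(_ _)/negP; apply=> // i.
by split; [|apply: f0].
Qed.

(** Maximality of facets: a form vanishing on [F] but not at [q] has the form defining [F] as a
    multiple, so its zeros in [P] lie in [F]. *)
Lemma facet_sub_face P F w b q : full_dim P -> is_facet P F ->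
  P q -> affine_form w b q != 0 -> F `<=` face_by P (affine_form w b) ->
  F = face_by P (affine_form w b).
Proof.
move=> fullP facetF Pq fq Fsub.
have [/is_faceP[w1 [b1 [_ FE]]] _] := facetF.
have [q1 Pq1 fq1] := facet_nonzero fullP facetF FE.
have F1 x : F x -> affine_form w1 b1 x = 0 by rewrite FE => -[].
have F2 x : F x -> affine_form w b x = 0 by move=> /Fsub[].
apply/seteqP; split=> // x [Px fx]; rewrite FE; split=> //=.
have := facet_form_unique fullP facetF F2 F1 fq x.
by move: fx => /= ->; rewrite mulr0.
Qed.

End Facets.

(** * Symmetries of cut polytopes *)

Section AffineMaps.
Variables (R : realFieldType) (V : lmodType R).
Implicit Types (g h : V -> V) (A F P : set V).

(** Linearity of [L] is stated through finite combinations, the shape in which hulls and affine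
    dependences are given. *)
Definition affine_map g := exists (L : V -> V) (t : V),
  (forall n (c : 'I_n -> R) (p : 'I_n -> V),
     L (\sum_i c i *: p i) = \sum_i c i *: L (p i)) /\
  forall x, g x = L x + t.

Lemma affine_map_comp g h : affine_map g -> affine_map h -> affine_map (g \o h).
Proof.
case=> [L [t [LL gE]]] [M [u [MM hE]]]; exists (L \o M), (L u + t); split=> [n c p|x].
  by rewrite /= MM LL.
rewrite /= hE gE addrA; congr (_ + _).
have := LL 2%N (fun=> 1) (fun i => if i == ord0 then M x else u).
by rewrite !big_ord_recl !big_ord0 /= !scale1r !addr0.
Qed.

Lemma affine_map_comb g n (c : 'I_n -> R) (p : 'I_n -> V) : affine_map g ->
  \sum_i c i = 1 -> g (\sum_i c i *: p i) = \sum_i c i *: g (p i).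
Proof.
case=> [L [t [LL gE]]] c1; rewrite gE LL; under [RHS]eq_bigr do rewrite gE scalerDr.
by rewrite big_split /= -scaler_suml c1 scale1r.
Qed.

Definition affine_iso P g h :=
  [/\ affine_map g, affine_map h, cancel g h, cancel h g &
      (forall x, P x -> P (g x)) /\ (forall x, P x -> P (h x))].

Lemma affine_isoC P g h : affine_iso P g h -> affine_iso P h g.
Proof. by case=> ? ? ? ? []. Qed.

Lemma affine_iso_comp P g h g' h' :
  affine_iso P g h -> affine_iso P g' h' -> affine_iso P (g \o g') (h' \o h).
Proof.
case=> ga ha gK hK [gP hP] [ga' ha' gK' hK' [gP' hP']].
split; try exact: affine_map_comp.
- exact: can_comp.
- exact: can_comp.
- by split=> x Px /=; auto.
Qed.

Variables (P : set V) (g h : V -> V).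
Hypothesis gh : affine_iso P g h.

Lemma image_face_by f : g @` face_by P f = face_by P (f \o h).
Proof.
case: gh => _ _ gK hK [gP hP]; apply/seteqP; split=> [_ [x [Px fx] <-]|x [Px fx]].
  by split=> /=; [apply: gP|rewrite gK].
by exists (h x); [split; [apply: hP|]|].
Qed.

Lemma aff_independent_image n (p : 'I_n -> V) :
  aff_independent p -> aff_independent (g \o p).
Proof.
case: gh => _ [L [t [LL hE]]] gK hK _ pI c c0 cgp; apply: pI => //.
transitivity (\sum_i c i *: h (g (p i))); first by apply: eq_bigr => i _; rewrite gK.
under eq_bigr do rewrite hE scalerDr.
rewrite big_split /= -scaler_suml c0 scale0r addr0 -LL cgp.
by have := LL 0%N (fun=> 0) (fun=> 0); rewrite !big_ord0.
Qed.

Lemma image_conv_hull A : g @` conv_hull A = conv_hull (g @` A).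
Proof.
case: gh => ga ha gK hK _; apply/seteqP; split.
  move=> _ [_ [n [p [c [Ap c0 c1 ->]]]] <-].
  exists n, (g \o p), c; split=> //; last exact: affine_map_comb.
  by move=> i; exists (p i).
move=> _ [n [p [c [Ap c0 c1 ->]]]]; exists (\sum_i c i *: h (p i)); last first.
  by rewrite affine_map_comb //; apply: eq_bigr => i _; rewrite hK.
exists n, (h \o p), c; split=> // i.
by have [x Ax xp] := Ap i; rewrite /= -xp gK.
Qed.

Lemma is_simplex_image F : is_simplex F -> is_simplex (g @` F).
Proof.
move=> [n [p [pI ->]]]; exists n, (g \o p); split; first exact: aff_independent_image.
rewrite image_conv_hull; congr conv_hull; apply/seteqP; split.
  by move=> _ [_ [i _ <-] <-]; exists i.
by move=> _ [i _ <-]; exists (p i) => //; exists i.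
Qed.

End AffineMaps.

Lemma aff_rank_image (R : realFieldType) (V : lmodType R) (P F : set V) g h r :
  affine_iso P g h -> aff_rank F r -> aff_rank (g @` F) r.
Proof.
move=> gh [[p [pI Fp]] Fmax]; split.
  exists (g \o p); split; first exact: (aff_independent_image gh).
  by move=> i; exists (p i).
have [_ _ gK _ _] := gh.
move=> n q qI gFq; apply: (Fmax _ (h \o q)).
  exact: (aff_independent_image (affine_isoC gh)).
by move=> i; have [x Fx xq] := gFq i; rewrite /= -xq gK.
Qed.

Lemma is_facet_image (R : realFieldType) (E : finType) (P F : set {ffun E -> R^o}) g h :
  affine_iso P g h ->
  (forall w b, exists w' b', affine_form w b \o h = affine_form w' b') ->
  is_facet P F -> is_facet P (g @` F).
Proof.
move=> gh formh [/is_faceP[w [b [Pw FE]]] [r [Pr Fr]]]; split; last first.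
  by exists r; split=> //; apply: aff_rank_image gh Fr.
have [w' [b' wE]] := formh w b; have [_ _ _ _ [_ hP]] := gh.
apply/is_faceP; exists w', b'; split; last by rewrite FE (image_face_by gh) wE.
by move=> x Px; rewrite -wE /=; apply/Pw/hP.
Qed.

(** * Switchings and automorphisms acting on the cut polytope *)

Section CutSymmetries.
Variables (V : finType) (G : sgraph V) (R : realFieldType).
Local Notation E := (edge G).
Local Notation RE := {ffun E -> R^o}.
Implicit Types (S U : {set V}) (e : E) (s : {perm V}) (x : RE).

Definition symdiff S U : {set V} := [set v | (v \in S) (+) (v \in U)]%SET.

Lemma edgeP e : exists u v, [/\ G u v, u != v & val e = [set u; v]%SET].
Proof.
case: e => /= A /existsP[u /existsP[v /andP[uv /eqP AE]]]; exists u, v; split=> //.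
by apply: contraTneq uv => ->; rewrite adj_irr.
Qed.

Lemma crossesE S e u v : u != v -> val e = [set u; v]%SET ->
  crosses S e = (u \in S) (+) (v \in S).
Proof.
move=> uv eE; rewrite /crosses eE finset.setIUl cardsU.
have -> : ([set u] :&: S :&: ([set v] :&: S) = finset.set0)%SET.
  apply/setP => z; rewrite !inE; case: (eqVneq z u) => [->|//].
  by rewrite (negbTE uv) /= andbF.
have card1 z : #|([set z] :&: S)%SET| = (z \in S).
  case: (boolP (z \in S)) => zS.
    by rewrite (finset.setIidPl _) ?cards1 // finset.sub1set.
  suff -> : ([set z] :&: S = finset.set0)%SET by rewrite cards0.
  by apply/setP => y; rewrite !inE; case: eqP => // ->; rewrite (negbTE zS).
by rewrite cards0 subn0 !card1; case: (u \in S); case: (v \in S).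
Qed.

Lemma crosses_symdiff S U e : crosses (symdiff S U) e = crosses S e (+) crosses U e.
Proof.
have [u [v [_ uv eE]]] := edgeP e.
by rewrite !(crossesE _ uv eE) !inE addbACA.
Qed.

Lemma crosses_set0 e : crosses finset.set0 e = false.
Proof. by have [u [v [_ uv eE]]] := edgeP e; rewrite (crossesE _ uv eE) !inE. Qed.

Lemma switching_switching S U x : switching S (switching U x) = switching (symdiff S U) x.
Proof.
apply/ffunP => e; rewrite !ffunE crosses_symdiff.
by case: (crosses S e); case: (crosses U e); rewrite //= opprB addrC subrK.
Qed.

Lemma switching0 x : switching finset.set0 x = x.
Proof. by apply/ffunP => e; rewrite ffunE crosses_set0. Qed.

Lemma switchingK U : involutive (@switching _ G R U).
Proof.
move=> x; rewrite switching_switching -[RHS]switching0; congr switching.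
by apply/setP => v; rewrite !inE addbb.
Qed.

Lemma switching_cut_vector U S :
  switching U (cut_vector G R S) = cut_vector G R (symdiff U S).
Proof.
apply/ffunP => e; rewrite !ffunE crosses_symdiff.
by case: (crosses U e); case: (crosses S e) => //=; rewrite ?subr0 ?subrr.
Qed.

Lemma automorphismV s : automorphism G s -> automorphism G s^-1.
Proof. by move=> sG u v; rewrite -sG !permKV. Qed.

Lemma automorphismM s t : automorphism G s -> automorphism G t -> automorphism G (s * t)%g.
Proof. by move=> sG tG u v; rewrite !permM tG sG. Qed.

Lemma val_aut_edge s e : automorphism G s -> val (aut_edge s e) = (s @: val e)%SET.
Proof.
move=> sG; rewrite /aut_edge val_insubd ifT //.
have [u [v [uv _ ->]]] := edgeP e.
apply/existsP; exists (s u); apply/existsP; exists (s v).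
by rewrite sG uv imsetU1 imset_set1 eqxx.
Qed.

Lemma aut_edgeM s t e : automorphism G s -> automorphism G t ->
  aut_edge (s * t)%g e = aut_edge t (aut_edge s e).
Proof.
move=> sG tG; apply: val_inj; rewrite !val_aut_edge //; last exact: automorphismM.
by rewrite -imset_comp; apply: eq_imset => v; rewrite permM.
Qed.

Lemma aut_edge1 e : aut_edge 1%g e = e.
Proof.
apply: val_inj; rewrite val_aut_edge; last by move=> u v; rewrite !perm1.
by rewrite (eq_imset _ (fun v => perm1 v)) imset_id.
Qed.

Lemma aut_edgeK s : automorphism G s -> cancel (@aut_edge _ G s) (aut_edge s^-1%g).
Proof.
by move=> sG e; rewrite -aut_edgeM ?mulgV ?aut_edge1 //; apply: automorphismV.
Qed.

Lemma crosses_aut_edge s S e : automorphism G s ->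
  crosses S (aut_edge s e) = crosses (s @^-1: S) e.
Proof.
move=> sG; have [u [v [_ uv eE]]] := edgeP e.
rewrite (crossesE _ uv eE) !inE.
apply: crossesE; first by rewrite (inj_eq perm_inj).
by rewrite val_aut_edge // eE imsetU1 imset_set1.
Qed.

Lemma aut_cut_vector s S : automorphism G s ->
  aut_action s (cut_vector G R S) = cut_vector G R (s @^-1: S).
Proof. by move=> sG; apply/ffunP => e; rewrite !ffunE crosses_aut_edge. Qed.

Lemma aut_action_switching s U x : automorphism G s ->
  aut_action s (switching U x) = switching (s @^-1: U) (aut_action s x).
Proof. by move=> sG; apply/ffunP => e; rewrite !ffunE crosses_aut_edge. Qed.

Lemma aut_actionM s t x : automorphism G s -> automorphism G t ->
  aut_action s (aut_action t x) = aut_action (s * t)%g x.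
Proof. by move=> sG tG; apply/ffunP => e; rewrite !ffunE aut_edgeM. Qed.

Lemma aut_actionK s : automorphism G s ->
  cancel (aut_action s : RE -> RE) (aut_action s^-1%g).
Proof.
move=> sG x; rewrite aut_actionM //; last exact: automorphismV.
by apply/ffunP => e; rewrite ffunE mulVg aut_edge1.
Qed.

(** Normal form in a semidirect product: automorphisms normalise the group of switchings, so by
    [switching_aut] every switching can be moved to the right of every automorphism. *)
Lemma cut_symmetryP (g : RE -> RE) : cut_symmetry g <->
  exists s U, automorphism G s /\ g = aut_action s \o switching U.
Proof.
have switching_aut s U x : automorphism G s ->
    switching U (aut_action s x) = aut_action s (switching (s @: U)%SET x).
  move=> sG; rewrite aut_action_switching //; congr switching.
  by apply/setP => v; rewrite !inE mem_imset //; apply: perm_inj.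
split=> [|[s [U [sG ->]]]]; last first.
  by apply: CutSymComp; [apply: CutSymAut|apply: CutSymSwitching].
have aut1 : automorphism G 1%g by move=> u v; rewrite !perm1.
have act1 x : aut_action 1%g x = x by apply/ffunP => e; rewrite ffunE aut_edge1.
elim=> {g} [|_ _ _ [s [U [sG ->]]] _ [t [W [tG ->]]]|_ h _ [s [U [sG ->]]] gK hK|U|s sG].
- by exists 1%g, finset.set0; split=> //; apply/funext => x /=; rewrite switching0.
- exists (s * t)%g, (symdiff (t @: U)%SET W); split; first exact: automorphismM.
  by apply/funext => x; rewrite /= switching_aut // switching_switching aut_actionM.
- exists s^-1%g, (s^-1%g @: U)%SET; split; first exact: automorphismV.
  apply/funext => x /=; rewrite -switching_aut; last exact: automorphismV.
  apply: (can_inj gK); rewrite hK /= switchingK.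
  by have := aut_actionK (automorphismV sG) x; rewrite invgK.
- by exists 1%g, U; split=> //; apply/funext => x /=.
- by exists s, finset.set0; split=> //; apply/funext => x /=; rewrite switching0.
Qed.

Lemma affine_map_switching U : affine_map (@switching _ G R U).
Proof.
exists (fun x => [ffun e => if crosses U e then - x e else x e]), (cut_vector G R U).
split=> [n c p|x]; apply/ffunP => e; rewrite !ffunE ?sum_ffunE.
  case: ifP => Ue; last by apply: eq_bigr => i _; rewrite !ffunE Ue.
  by rewrite -sumrN; apply: eq_bigr => i _; rewrite !ffunE Ue scalerN.
by case: crosses; rewrite ?addr0 // addrC.
Qed.

Lemma affine_map_aut_action s : affine_map (aut_action s : RE -> RE).
Proof.
exists (aut_action s), 0; split=> [n c p|x]; last by rewrite addr0.
by apply/ffunP => e; rewrite !ffunE !sum_ffunE; apply: eq_bigr => i _; rewrite !ffunE.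
Qed.

Lemma conv_hull_map (g : RE -> RE) A : affine_map g ->
  (forall x, A x -> A (g x)) -> forall x, conv_hull A x -> conv_hull A (g x).
Proof.
move=> ga Ag _ [n [p [c [Ap c0 c1 ->]]]]; exists n, (g \o p), c; split=> //.
  by move=> i; apply/Ag/Ap.
exact: affine_map_comb.
Qed.

Lemma affine_iso_switching U :
  affine_iso (cutp G R) (switching U) (switching U).
Proof.
have mapU x : cutp G R x -> cutp G R (switching U x).
  apply: (conv_hull_map (affine_map_switching U)) => _ [S _ <-].
  by rewrite switching_cut_vector; exists (symdiff U S).
by split=> //; try exact: affine_map_switching; exact: switchingK.
Qed.

Lemma affine_iso_aut_action s : automorphism G s ->
  affine_iso (cutp G R) (aut_action s) (aut_action s^-1%g).
Proof.
have mapG t : automorphism G t -> forall x, cutp G R x -> cutp G R (aut_action t x).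
  move=> tG; apply: (conv_hull_map (affine_map_aut_action t)) => _ [S _ <-].
  by rewrite aut_cut_vector //; exists (t @^-1: S)%SET.
move=> sG; have sVG := automorphismV sG.
split; try exact: affine_map_aut_action; first exact: aut_actionK.
  by have := aut_actionK sVG; rewrite invgK.
by split; apply: mapG.
Qed.

Lemma cut_symmetry_iso (g : RE -> RE) : cut_symmetry g ->
  exists2 h, cut_symmetry h & affine_iso (cutp G R) g h.
Proof.
move=> /cut_symmetryP[s [U [sG ->]]].
exists (switching U \o aut_action s^-1%g).
  by apply: CutSymComp; [apply: CutSymSwitching|apply/CutSymAut/automorphismV].
exact: affine_iso_comp (affine_iso_aut_action sG) (affine_iso_switching U).
Qed.

(** The new constant is the value at the cut vector of [U] because the switching sends the origin
    there. *)
Lemma affine_form_switching (w : E -> R) b U :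
  affine_form w b \o switching U =
  affine_form (fun e => if crosses U e then - w e else w e)
              (affine_form w b (cut_vector G R U)).
Proof.
apply/funext => x; rewrite /affine_form /linear_form /= addrA -big_split /=.
congr (_ + _); apply: eq_bigr => e _; rewrite !ffunE.
by case: crosses; rewrite ?mulr0 ?addr0 // mulrBr addrC mulNr.
Qed.

Lemma affine_form_aut_action (w : E -> R) b s : automorphism G s ->
  affine_form w b \o aut_action s = affine_form (fun e => w (aut_edge s^-1%g e)) b.
Proof.
move=> sG; apply/funext => x; rewrite /affine_form /linear_form /=; congr (_ + _).
have bij : bijective (@aut_edge _ G s).
  exists (aut_edge s^-1%g); first exact: aut_edgeK.
  by have := aut_edgeK (automorphismV sG); rewrite invgK.
rewrite [RHS](reindex (aut_edge s)) /=; last exact: onW_bij.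
by apply: eq_bigr => e _; rewrite ffunE aut_edgeK.
Qed.

Lemma affine_form_cut_symmetry (g : RE -> RE) (w : E -> R) b : cut_symmetry g ->
  exists w' b', affine_form w b \o g = affine_form w' b'.
Proof.
move=> /cut_symmetryP[s [U [sG ->]]].
rewrite compA affine_form_aut_action // affine_form_switching.
by do 2!eexists.
Qed.

Lemma cut_symmetry_facet (g : RE -> RE) F : cut_symmetry g ->
  is_facet (cutp G R) F -> is_facet (cutp G R) (g @` F).
Proof.
move=> gS; have [h hS gh] := cut_symmetry_iso gS.
by apply: is_facet_image gh _ => w b; apply: affine_form_cut_symmetry.
Qed.

(** The image of a face under [g] is cut out by the form composed with the inverse of [g]; as
    inverses belong to the group, orbits of faces become orbits of forms, which can be computed. *)
Lemma cut_orbit_face (f : RE -> R) :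
  cut_orbit (face_by (cutp G R) f) =
  [set face_by (cutp G R) (f \o g) | g in @cut_symmetry _ G R].
Proof.
apply/seteqP; split=> [_ [g gS <-]|_ [h hS <-]].
  by have [h hS gh] := cut_symmetry_iso gS; exists h; rewrite ?(image_face_by gh).
have [g gS hg] := cut_symmetry_iso hS.
by exists g; rewrite ?(image_face_by (affine_isoC hg)).
Qed.

Lemma cut_orbit_eq F F' : cut_orbit F F' -> @cut_orbit _ G R F' = cut_orbit F.
Proof.
move=> [g gS <-]; have [h hS [_ _ gK hK _]] := cut_symmetry_iso gS.
apply/seteqP; split=> [_ [k kS <-]|_ [k kS <-]].
  by exists (k \o g); [apply: CutSymComp|rewrite image_comp].
exists (k \o h); first exact: CutSymComp.
by rewrite image_comp; congr (_ @` _); apply/funext => x /=; rewrite gK.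
Qed.

End CutSymmetries.

(** * The Petersen graph in lists *)

(** Vertex i is numbered i - 1 and vertex i' is numbered i + 4. The edges come in the order of the
    cycle (1,2,3,4,5), then of (1',4',2',5',3'), then the spokes; all lists indexed by edges follow
    this order. *)
Definition pairs : seq (nat * nat) :=
  [:: (0, 1); (1, 2); (2, 3); (3, 4); (0, 4);
      (5, 8); (6, 8); (6, 9); (7, 9); (5, 7);
      (0, 5); (1, 6); (2, 7); (3, 8); (4, 9)]%N.

Definition adj_table : seq (seq bool) :=
  [seq [seq ((a, b) \in pairs) || ((b, a) \in pairs) | b <- iota 0 10] | a <- iota 0 10].

Definition adjn (a b : nat) : bool := nth false (nth [::] adj_table a) b.

Fixpoint bitseqs (k : nat) : seq (seq bool) :=
  if k is k'.+1 then
    let B := bitseqs k' in [seq false :: b | b <- B] ++ [seq true :: b | b <- B]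
  else [:: [::]].

Definition cutbits (u : seq bool) : seq bool :=
  [seq nth false u p.1 (+) nth false u p.2 | p <- pairs].

Arguments cutbits : simpl never.

(** Nine bits suffice: vertex 9 receives the default [false], which selects one of the two
    complementary sets defining a cut. *)
Definition cuts : seq (seq bool) := [seq cutbits u | u <- bitseqs 9].

Definition zbit (b : bool) : Z := if b then 1%Z else 0%Z.

(* The list w encodes the form w_0 x_0 + .. + w_14 x_14 + w_15. *)
Definition value (w : seq Z) (k : seq bool) : Z := dotz w (rcons (map zbit k) 1%Z).

Definition swz (k : seq bool) (w : seq Z) : seq Z :=
  rcons [seq (if bc.1 then - bc.2 else bc.2)%Z | bc <- zip k (take 15 w)]
        (dotz w (rcons (map zbit k) 1%Z)).

Definition edgep (i : nat) := nth (0, 0)%N pairs i.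

Definition pair_index (a b : nat) : nat :=
  find (fun p => (p == (a, b)) || (p == (b, a))) pairs.

Definition edge_image (s : seq nat) (i : nat) : nat :=
  pair_index (nth 0%N s (edgep i).1) (nth 0%N s (edgep i).2).

(** [index j im] is the edge sent to [j]: composing a form with an automorphism permutes its
    coefficients by the inverse. *)
Definition autz (s : seq nat) (w : seq Z) : seq Z :=
  let im := [seq edge_image s i | i <- iota 0 15] in
  rcons [seq nth 0%Z w (index j im) | j <- iota 0 15] (nth 0%Z w 15).

Definition extend (k : nat) (l : seq nat) : seq (seq nat) :=
  [seq rcons l v | v <- iota 0 10 &
     all (fun i => (nth 0%N l i != v) && (adjn (nth 0%N l i) v == adjn i k)) (iota 0 k)].

(** Backtracking over embeddings of the subgraph induced on the first [k] vertices. *)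
Fixpoint partial_auts (k : nat) : seq (seq nat) :=
  if k is k'.+1 then flatten [seq extend k' l | l <- partial_auts k'] else [:: [::]].

Definition auts := partial_auts 10.

Definition w_edge : seq Z := [:: 1; 0;0;0;0; 0;0;0;0;0; 0;0;0;0;0; 0]%Z.
Definition w_pent : seq Z := [:: 1; 1; 1; 1; -1; 0;0;0;0;0; 0;0;0;0;0; 0]%Z.
(** The 6-cycle runs through the vertices 0, 1, 2, 3, 8, 5. *)
Definition w_hex : seq Z := [:: 1; 1; 1; 0; 0; 1; 0; 0; 0; 0; -1; 0; 0; 1; 0; 0]%Z.
Definition w_simp : seq Z := [:: 1; 1; 1; 1; -1; 1;-1;1;-1;-1; 2;2;2;2;2; 0]%Z.

Definition xorb2 (k l : seq bool) : seq bool := [seq bc.1 (+) bc.2 | bc <- zip k l].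

(* The functional (c, b) |-> sum_{e in m} c_e - b. *)
Definition member_cons (m : seq bool) : seq Z := rcons (map zbit m) (-1)%Z.

Definition incident (v i : nat) : bool := ((edgep i).1 == v) || ((edgep i).2 == v).

(* The triangle inequality at the vertex v, violated when c_j exceeds the sum of
   the other two weights. *)
Definition star_vec (v j : nat) : seq Z :=
  rcons [seq if incident v i then if i == j then (-1)%Z else 1%Z else 0%Z | i <- iota 0 15] 0%Z.

Definition star_cons : seq (seq Z) :=
  flatten [seq [seq star_vec v j | j <- iota 0 15 & incident v j] | v <- iota 0 10].

Definition edge_form (b : bool) (j : nat) : seq Z :=
  rcons [seq if i == j then if b then (-1)%Z else 1%Z else 0%Z | i <- iota 0 15] (zbit b).

Definition is_matching (m : seq bool) : bool :=
  all (fun v => count (fun i => nth false m i && incident v i) (iota 0 15) <= 1)%N (iota 0 10).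

Definition members (k : seq bool) : seq (seq bool) := [seq xorb2 k c | c <- cuts].

(* Under the triangle inequalities at the vertices, some matching has least weight
   among the members of the class of k. *)
Definition class_cons (k : seq bool) : seq (seq Z) :=
  let M := [seq m <- members k | is_matching m] in
  star_cons ++ flatten [seq [seq member_cons m | m <- M & count id m == i] | i <- iota 0 6].

Definition edge_bits (s : seq nat) : seq bool := [seq i \in s | i <- iota 0 15].

(* The edges of pairs in positions 0 to 3 and 10 to 14 form a spanning tree, on
   which the switching by this potential makes k vanish. *)
Definition potential (k : seq bool) : seq bool :=
  let p1 := nth false k 0 in
  let p2 := p1 (+) nth false k 1 in
  let p3 := p2 (+) nth false k 2 in
  let p4 := p3 (+) nth false k 3 in
  [:: false; p1; p2; p3; p4; nth false k 10; p1 (+) nth false k 11;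
      p2 (+) nth false k 12; p3 (+) nth false k 13; p4 (+) nth false k 14].

Definition canon (k : seq bool) : seq bool := xorb2 k (cutbits (potential k)).

(** The possible values of [canon]: the six edges outside the spanning tree are in positions 4 to 9,
    and each of the 64 classes has one member vanishing on the tree. *)
Definition off_tree : seq (seq bool) :=
  [seq nseq 4 false ++ b ++ nseq 5 false | b <- bitseqs 6].

Definition autbits (s : seq nat) (k : seq bool) : seq bool :=
  let im := [seq edge_image s i | i <- iota 0 15] in
  [seq nth false k (index j im) | j <- iota 0 15].

(* The 64 classes of edge sets modulo cuts form six orbits under the automorphisms. *)
Definition class_reps : seq (seq bool) :=
  [seq canon (edge_bits s) |
     s <- [:: [::]; [:: 0]; [:: 0; 2]; [:: 0; 8]; [:: 0; 2; 5]; [:: 0; 8; 13]]%N].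

Definition dedupe (T : Type) (eqt : T -> T -> bool) (s : seq T) : seq T :=
  foldl (fun acc x => if has (eqt x) acc then acc else x :: acc) [::] s.

Fixpoint eqzs (s t : seq Z) : bool :=
  match s, t with
  | x :: s', y :: t' => if (x =? y)%Z then eqzs s' t' else false
  | [::], [::] => true
  | _, _ => false
  end.

(** Switchings change only signs of edge coefficients, so one image of [w] is kept for each list of
    absolute values. That images with equal absolute values differ by a switching is what
    [orbit_check] tests. *)
Definition aut_types (w : seq Z) : seq (seq Z) :=
  dedupe (fun w1 w2 => eqzs (map Z.abs (take 15 w1)) (map Z.abs (take 15 w2)))
    [seq autz s w | s <- auts].

Definition orbit_list (w : seq Z) : seq (seq Z) :=
  flatten [seq dedupe eqzs [seq swz c v | c <- cuts] | v <- aut_types w].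

Definition bases : seq (seq Z) := [:: w_edge; w_pent; w_hex; w_simp].

Definition orbit_lists : seq (seq (seq Z)) := map orbit_list bases.

(** Restricts the search in [ray_check] to the listed forms whose signs belong to the pattern
    [k]. *)
Definition sign_compatible (k : seq bool) (w : seq Z) : bool :=
  all (fun bc : bool * Z => if bc.1 then (bc.2 <=? 0)%Z else (0 <=? bc.2)%Z) (zip k (take 15 w)).

Definition ray_check (k : seq bool) (cand : seq (seq Z)) (r : seq Z) : bool :=
  let vals := [seq (c, dotz (member_cons (xorb2 k c)) r) | c <- cuts] in
  if all (fun cv : seq bool * Z => 0 <=? cv.2)%Z vals then
    let tight := [seq rcons (map zbit cv.1) 1%Z | cv <- vals & (cv.2 =? 0)%Z] in
    has (fun w => all (fun c => dotz w c =? 0)%Z tight) cand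
  else false.

Definition class_check (k : seq bool) : bool :=
  if cone_rays 16 (unit_vectors 16) (orthant_rays 16) (class_cons k) is Some L then
    let cand := [seq w <- flatten orbit_lists | sign_compatible k w] in
    all (fun r : ray => ray_check k cand r.1) L
  else false.

(** * The Petersen graph and its encoding by lists *)

Definition vertex_index (v : petersen_vertex) : nat :=
  match v with inl i => nat_of_ord i | inr i => (5 + i)%N end.

Definition vertex (k : nat) : petersen_vertex :=
  if (k < 5)%N then inl (inord k) else inr (inord (k - 5)).

Lemma vertex_index_lt v : (vertex_index v < 10)%N.
Proof. by case: v => i /=; rewrite ?(ltn_add2l 5 i 5) ?(leq_trans (ltn_ord i)). Qed.

Lemma vertex_indexK : cancel vertex_index vertex.
Proof.
case=> i; rewrite /vertex; first by rewrite ltn_ord inord_val.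
by rewrite -[vertex_index _]/(5 + i)%N addKn inord_val ltnNge leq_addr.
Qed.

Lemma vertexK k : (k < 10)%N -> vertex_index (vertex k) = k.
Proof.
move=> k10; rewrite /vertex; case: ltnP => k5 /=; first by rewrite inordK.
by rewrite inordK ?subnKC // ltn_subLR.
Qed.

Lemma petersen_adjE u v : petersen u v = adjn (vertex_index u) (vertex_index v).
Proof.
by case: u => -[[|[|[|[|[|i]]]]] //= ?]; case: v => -[[|[|[|[|[|j]]]]] //= ?].
Qed.

Lemma adjn_vertex a b : (a < 10)%N -> (b < 10)%N -> petersen (vertex a) (vertex b) = adjn a b.
Proof. by move=> a10 b10; rewrite petersen_adjE !vertexK. Qed.

Lemma pairs_adjn : all (fun p => [&& (p.1 < 10)%N, (p.2 < 10)%N & adjn p.1 p.2]) pairs.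
Proof. by vm_compute. Qed.

Lemma edgepP i : (i < 15)%N ->
  [/\ ((edgep i).1 < 10)%N, ((edgep i).2 < 10)%N & adjn (edgep i).1 (edgep i).2].
Proof. by move=> i15; apply/and3P; apply: (allP pairs_adjn); apply: mem_nth. Qed.

Lemma ed_subproof (i : 'I_15) :
  is_edge petersen [set vertex (edgep i).1; vertex (edgep i).2]%SET.
Proof.
have [a10 b10 ab] := edgepP (ltn_ord i).
apply/existsP; exists (vertex (edgep i).1); apply/existsP; exists (vertex (edgep i).2).
by rewrite eqxx andbT adjn_vertex.
Qed.

Definition ed (i : 'I_15) : edge petersen := Sub _ (ed_subproof i).

Lemma val_ed i : val (ed i) = [set vertex (edgep i).1; vertex (edgep i).2]%SET.
Proof. by []. Qed.

Lemma vertex_eq a b : (a < 10)%N -> (b < 10)%N -> (vertex a == vertex b) = (a == b).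
Proof. by move=> a10 b10; apply/eqP/eqP => [/(congr1 vertex_index)|->//]; rewrite !vertexK. Qed.

Lemma mem_ed (i : 'I_15) k : (k < 10)%N -> (vertex k \in val (ed i)) = incident k i.
Proof.
move=> k10; have [a10 b10 _] := edgepP (ltn_ord i).
by rewrite val_ed !inE !vertex_eq // /incident eq_sym [in X in _ || X]eq_sym.
Qed.

Lemma incident_inj :
  all (fun i => all (fun j => (i == j) ||
         has (fun k => incident k i != incident k j) (iota 0 10)) (iota 0 15)) (iota 0 15).
Proof. by vm_compute. Qed.

Lemma ed_inj : injective ed.
Proof.
move=> i j eq_ij; apply/val_inj/eqP.
have mem15 (l : 'I_15) : (l : nat) \in iota 0 15 by rewrite mem_iota ltn_ord.
have := allP (allP incident_inj _ (mem15 i)) _ (mem15 j).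
case/orP=> // /hasP[k]; rewrite mem_iota /= add0n => k10.
by rewrite -!mem_ed // eq_ij eqxx.
Qed.

Definition is_pair a b (p : nat * nat) := (p == (a, b)) || (p == (b, a)).

Lemma pair_index_lt a b : adjn a b -> (a < 10)%N -> (b < 10)%N -> (pair_index a b < 15)%N.
Proof.
have H : all (fun a => all (fun b => adjn a b ==> (pair_index a b < 15)%N) (iota 0 10)) (iota 0 10).
  by vm_compute.
move=> ab a10 b10; apply: (implyP (allP (allP H a _) b _)) => //; by rewrite mem_iota.
Qed.

Lemma edgep_pair_index a b : (pair_index a b < 15)%N -> is_pair a b (edgep (pair_index a b)).
Proof. by rewrite -[15%N]/(size pairs) -has_find => /(nth_find (0, 0)%N). Qed.

Lemma ed_eq (e : edge petersen) a b (i : 'I_15) :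
  val e = [set vertex a; vertex b]%SET -> is_pair a b (edgep i) -> e = ed i.
Proof.
move=> eE ab; apply: val_inj; rewrite eE val_ed.
by case/orP: ab => /eqP -> //=; rewrite finset.setUC.
Qed.

Lemma ed_surj (e : edge petersen) : exists i, e = ed i.
Proof.
have [u [v [uv _ eE]]] := edgeP e.
have ab : adjn (vertex_index u) (vertex_index v) by rewrite -petersen_adjE.
have lt := pair_index_lt ab (vertex_index_lt u) (vertex_index_lt v).
exists (Ordinal lt); apply: (@ed_eq e _ _ (Ordinal lt) _ (edgep_pair_index lt)).
by rewrite !vertex_indexK.
Qed.

Lemma ed_bij : bijective ed.
Proof.
apply: inj_card_bij => //; first exact: ed_inj.
rewrite -(card_codom ed_inj) subset_leq_card //; apply/fintype.subsetP => e _.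
by have [i ->] := ed_surj e; apply: codom_f.
Qed.

Lemma card_petersen_edge : #|{: edge petersen}| = 15%N.
Proof. by rewrite -(bij_eq_card ed_bij) card_ord. Qed.

Definition ei (e : edge petersen) : 'I_15 := odflt ord0 [pick i | ed i == e].

Lemma edK : cancel ed ei.
Proof. by move=> i; rewrite /ei; case: pickP => [j /eqP/ed_inj|/(_ i)]; rewrite ?eqxx. Qed.

Lemma eiK : cancel ei ed.
Proof. by move=> e; have [i ->] := ed_surj e; rewrite edK. Qed.

Definition set_of (u : seq bool) : {set petersen_vertex} :=
  [set v | nth false u (vertex_index v)]%SET.

Definition bits_of (S : {set petersen_vertex}) : seq bool := [seq vertex k \in S | k <- iota 0 10].

Lemma bits_ofK : cancel bits_of set_of.
Proof.
move=> S; apply/setP => v; rewrite inE /bits_of (nth_map 0%N) ?size_iota ?vertex_index_lt //.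
by rewrite nth_iota ?vertex_index_lt // vertex_indexK.
Qed.

Lemma crosses_set_of u (i : 'I_15) :
  crosses (set_of u) (ed i) = nth false (cutbits u) i.
Proof.
have [a10 b10 ab] := edgepP (ltn_ord i).
have neq : vertex (edgep i).1 != vertex (edgep i).2.
  by rewrite vertex_eq //; apply: contraTneq ab => ->; rewrite -adjn_vertex // adj_irr.
rewrite (crossesE _ neq (val_ed i)) !inE !vertexK //.
by rewrite (nth_map (0, 0)%N).
Qed.

Lemma crosses_setC (S : {set petersen_vertex}) (e : edge petersen) : crosses (~: S)%SET e = crosses S e.
Proof.
have [u [v [_ uv eE]]] := edgeP e.
by rewrite !(crossesE _ uv eE) !inE; case: (u \in S); case: (v \in S).
Qed.

Lemma mem_bitseqs n (u : seq bool) : (u \in bitseqs n) = (size u == n).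
Proof.
elim: n u => [|n IH] [|b u] //=; rewrite ?mem_cat.
  by apply/negP => /orP[] /mapP[].
have consP c : (b :: u \in [seq c :: v | v <- bitseqs n]) = (b == c) && (u \in bitseqs n).
  apply/mapP/andP => [[v vn [-> ->]]|[/eqP-> un]]; first by rewrite eqxx.
  by exists u.
by rewrite !consP IH {consP}; case: b; rewrite /= ?orbF.
Qed.

(* Complementing S if necessary, the last vertex may be assumed not to be in S. *)
Lemma cut_set_of (S : {set petersen_vertex}) :
  exists2 u, u \in bitseqs 9 & @crosses _ petersen S =1 crosses (set_of u).
Proof.
wlog S9 : S / vertex 9 \notin S => [H|].
  case: (boolP (vertex 9 \in S)) => S9; last exact: H.
  have [|u un Su] := H (~: S)%SET; first by rewrite inE S9.
  by exists u => // e; rewrite -Su crosses_setC.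
exists (take 9 (bits_of S)); first by rewrite mem_bitseqs.
move=> e; congr (crosses _ e); rewrite -[LHS]bits_ofK; apply/setP => v; rewrite !inE.
have v10 := vertex_index_lt v.
have [v9|v9] := ltnP (vertex_index v) 9; first by rewrite nth_take.
have vE : vertex_index v = 9%N by apply/eqP; rewrite eqn_leq v9 andbT -ltnS.
by rewrite vE /= (negbTE S9).
Qed.

Lemma nth_rcons_last (T : Type) (x0 : T) s y n : size s = n -> nth x0 (rcons s y) n = y.
Proof. by move=> <-; rewrite nth_rcons ltnn eqxx. Qed.

Section ListForms.
Variable R : realFieldType.
Local Notation RE := {ffun edge petersen -> R^o}.
Local Notation P := (cutp petersen R).
Local Notation delta := (cut_vector petersen R).

Lemma sum_ed (F : edge petersen -> R) : \sum_e F e = \sum_(i < 15) F (ed i).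
Proof. by rewrite (reindex ed) //; apply: onW_bij ed_bij. Qed.

Definition lform (w : seq Z) : RE -> R :=
  affine_form (fun e => zr R (nth 0%Z w (ei e))) (zr R (nth 0%Z w 15)).

Lemma lformE w x : lform w x =
  \sum_(i < 15) zr R (nth 0%Z w i) * x (ed i) + zr R (nth 0%Z w 15).
Proof.
rewrite /lform /affine_form /linear_form sum_ed; congr (_ + _).
by apply: eq_bigr => i _; rewrite edK.
Qed.

Lemma size_cutbits u : size (cutbits u) = 15%N.
Proof. by rewrite size_map. Qed.

Lemma lform_cut w u : size w = 16%N ->
  lform w (delta (set_of u)) = zr R (value w (cutbits u)).
Proof.
move=> w16; have k15 := size_cutbits u; have kE := crosses_set_of u.
move: (cutbits u) k15 kE => k k15 kE.
rewrite /value -(@dotz_sum _ 16) ?w16 // big_ord_recr /= lformE; congr (_ + _).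
  apply: eq_bigr => i _; congr (_ * _).
  rewrite nth_rcons size_map k15 ltn_ord (nth_map false) ?k15 //.
  by rewrite ffunE kE; case: nth.
by rewrite (nth_rcons_last _ _ (n := 15)) ?size_map ?mulr1.
Qed.

Lemma size_swz k w : size k = 15%N -> size w = 16%N -> size (swz k w) = 16%N.
Proof.
by move=> k15 w16; rewrite size_rcons size_map size_zip size_take k15 w16.
Qed.

Lemma lform_switching w u : size w = 16%N ->
  lform w \o switching (set_of u) = lform (swz (cutbits u) w).
Proof.
move=> w16; have k15 := size_cutbits u; have kE := crosses_set_of u.
have := lform_cut u w16; move: (cutbits u) k15 kE => k k15 kE w_cut.
rewrite /lform affine_form_switching -/(lform w) w_cut; congr affine_form.
  apply/funext => e; rewrite -[e in LHS]eiK kE.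
  have zk : (ei e < size (zip k (take 15 w)))%N.
    by rewrite size_zip size_take k15 w16.
  rewrite nth_rcons size_map zk (nth_map (false, 0%Z)) // nth_zip; last first.
    by rewrite size_take k15 w16.
  by rewrite edK /fst /snd nth_take ?ltn_ord //; case: (nth false k _); rewrite ?zrN.
rewrite /swz (nth_rcons_last _ _ (n := 15)) //.
by rewrite size_map size_zip size_take k15 w16.
Qed.

Lemma switching_eq (U W : {set petersen_vertex}) : @crosses _ petersen U =1 crosses W ->
  @switching _ petersen R U = switching W.
Proof. by move=> UW; apply/funext => x; apply/ffunP => e; rewrite !ffunE UW. Qed.

Definition perm_bits (s : {perm petersen_vertex}) : seq nat :=
  [seq vertex_index (s (vertex k)) | k <- iota 0 10].

Lemma nth_perm_bits s k : (k < 10)%N -> nth 0%N (perm_bits s) k = vertex_index (s (vertex k)).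
Proof. by move=> k10; rewrite (nth_map 0%N) ?size_iota // nth_iota. Qed.

(** Each prefix of an automorphism passes the test of [extend], so the backtracking misses none. *)
Lemma partial_autsP (s : {perm petersen_vertex}) k : automorphism petersen s ->
  (k <= 10)%N -> take k (perm_bits s) \in partial_auts k.
Proof.
move=> sG; elim: k => [|k IH] k10; first by rewrite take0.
have size_s : size (perm_bits s) = 10%N by rewrite size_map.
apply/flattenP; exists (extend k (take k (perm_bits s))).
  by apply: map_f; apply: IH; apply: ltnW.
rewrite (take_nth 0%N) ?size_s //.
apply: (map_f (rcons _)); rewrite mem_filter mem_iota /= nth_perm_bits // vertex_index_lt andbT.
apply/allP => i; rewrite mem_iota /= add0n => ik.
have i10 := ltn_trans ik k10.
rewrite nth_take // nth_perm_bits // -!petersen_adjE sG adjn_vertex // eqxx andbT.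
apply/eqP => /(can_inj vertex_indexK)/perm_inj/eqP.
by rewrite vertex_eq // ltn_eqF.
Qed.

Lemma auts_complete s : automorphism petersen s -> perm_bits s \in auts.
Proof.
move=> sG; have := partial_autsP sG (leqnn 10).
by rewrite take_oversize // size_map.
Qed.

Lemma auts_sound l : l \in auts -> exists2 s, automorphism petersen s & perm_bits s = l.
Proof.
have H : all (fun l => [&& size l == 10%N, all (fun v => v < 10)%N l, uniq l &
    all (fun i => all (fun j => adjn (nth 0%N l i) (nth 0%N l j) == adjn i j) (iota 0 10))
      (iota 0 10)]) auts by vm_compute.
move=> /(allP H)/and4P[/eqP l10 /allP l_lt l_uniq adj_l] {H}.
have lt k : (k < 10)%N -> (nth 0%N l k < 10)%N by move=> k10; apply: l_lt; rewrite mem_nth ?l10.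
pose f v := vertex (nth 0%N l (vertex_index v)).
have f_inj : injective f.
  move=> u v /(congr1 vertex_index); rewrite !vertexK ?lt ?vertex_index_lt // => /eqP.
  by rewrite nth_uniq ?l10 ?vertex_index_lt // => /eqP/(can_inj vertex_indexK).
exists (perm f_inj).
  move=> u v; rewrite !permE /f adjn_vertex ?lt ?vertex_index_lt // petersen_adjE.
  by apply/eqP; apply: (allP (allP adj_l _ _)); rewrite mem_iota vertex_index_lt.
apply: (@eq_from_nth _ 0%N) => [|k]; first by rewrite size_map l10.
rewrite size_map => k10; rewrite nth_perm_bits // permE /f vertexK ?vertexK ?lt //.
Qed.

Lemma edge_image_perm s (i : 'I_15) : automorphism petersen s ->
  exists2 j : 'I_15, edge_image (perm_bits s) i = j & aut_edge s (ed i) = ed j.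
Proof.
move=> sG; have [a10 b10 ab] := edgepP (ltn_ord i).
have lt : (edge_image (perm_bits s) i < 15)%N.
  rewrite /edge_image !nth_perm_bits //; apply: pair_index_lt; rewrite ?vertex_index_lt //.
  by rewrite -petersen_adjE sG adjn_vertex.
exists (Ordinal lt); first by [].
apply: (@ed_eq _ _ _ (Ordinal lt) _ (edgep_pair_index lt)).
rewrite val_aut_edge // val_ed imsetU1 imset_set1 !nth_perm_bits //.
by rewrite !vertex_indexK.
Qed.

Lemma nth_autz s w j : (j < 15)%N ->
  nth 0%Z (autz s w) j = nth 0%Z w (index j [seq edge_image s i | i <- iota 0 15]).
Proof.
move=> j15; rewrite /autz nth_rcons size_map size_iota j15.
rewrite (nth_map 0%N); last by rewrite size_iota.
by rewrite nth_iota; last exact: j15.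
Qed.

Lemma nth_autz_last s w : nth 0%Z (autz s w) 15 = nth 0%Z w 15.
Proof. by rewrite /autz nth_rcons size_map size_iota. Qed.

Lemma eq_affine_form (f g : edge petersen -> R) b c : f =1 g -> b = c ->
  affine_form f b = affine_form g c.
Proof. by move=> /funext -> ->. Qed.

Lemma aut_edgeV_ed s (j : 'I_15) : automorphism petersen s ->
  exists2 k : 'I_15, index (j : nat) [seq edge_image (perm_bits s) i | i <- iota 0 15] = k &
    aut_edge s^-1%g (ed j) = ed k.
Proof.
move=> sG; set im := [seq _ | i <- _].
have [i iE] := ed_surj (aut_edge s^-1%g (ed j)).
have eE : ed j = aut_edge s (ed i).
  by rewrite -iE; have := aut_edgeK (automorphismV sG) (ed j); rewrite invgK.
have [j0 im_i si] := edge_image_perm i sG.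
have j0j : j0 = j by apply: ed_inj; rewrite eE.
have j_im : (j : nat) \in im.
  by rewrite -j0j -im_i; apply: map_f; rewrite mem_iota ltn_ord.
have [k kE] : exists k : 'I_15, index (j : nat) im = k.
  have lt : (index (j : nat) im < 15)%N.
    by move: j_im; rewrite -index_mem size_map size_iota.
  by exists (Ordinal lt).
exists k; first exact: kE.
have [j' im_j sj] := edge_image_perm k sG.
have jj : j' = j.
  apply: val_inj; rewrite /= -im_j -[RHS](nth_index 0%N j_im) kE.
  rewrite (nth_map 0%N); last by rewrite size_iota.
  by rewrite nth_iota.
by rewrite -jj -sj aut_edgeK; last exact: sG.
Qed.

Lemma lform_aut_action w s : automorphism petersen s ->
  lform w \o aut_action s = lform (autz (perm_bits s) w).
Proof.
move=> sG; rewrite /lform nth_autz_last affine_form_aut_action; last exact: sG.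
apply: eq_affine_form => [e|]; last exact: erefl.
rewrite nth_autz; last exact: ltn_ord.
have [k -> kE] := aut_edgeV_ed (ei e) sG.
by rewrite -{1}[e]eiK kE edK.
Qed.

Lemma size_autz s w : size (autz s w) = 16%N.
Proof. by rewrite size_rcons size_map size_iota. Qed.

Lemma valid_lform w : size w = 16%N -> all (fun c => 0 <=? value w c)%Z cuts ->
  forall x, P x -> 0 <= lform w x.
Proof.
move=> w16 /allP wc; apply: conv_hull_ge0 => _ [S _ <-].
have [u u9 Su] := cut_set_of S.
have -> : delta S = delta (set_of u) by apply/ffunP => e; rewrite !ffunE Su.
by rewrite -/(lform w) lform_cut // zr_ge0; apply/wc/map_f.
Qed.

End ListForms.

(** * Certificates for the four base facets *)

Definition tight_edge : seq nat :=
  [:: 0; 1; 2; 4; 8; 16; 32; 64; 5; 9; 10; 48; 66; 384; 388]%N.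

(** The rows are scaled to integers: each has only to be nonzero at its own tight cut. This
    determines a row up to a scalar and a multiple of the facet form. *)
Definition dual_edge : seq (seq Z) :=
   [:: [:: -1; 0; -1; -1; -1; -1; -1; 0; 0; -1; 0; -1; -1; 0; 0; 2];
      [:: 0; 0; 0; 0; 1; 1; 1; -1; 0; 0; -1; 0; 0; 0; -1; 0];
      [:: 1; -1; 0; 0; 2; 0; 0; 0; 0; 1; -1; 0; 1; 0; -2; 0];
      [:: 0; -1; 1; 0; 0; 0; 1; 0; 0; 0; 0; 1; 0; -1; 0; 0];
      [:: 1; -1; 1; 0; 1; 1; 0; 0; -1; 1; 0; 0; 0; -1; -1; 0];
      [:: -1; 1; -1; 1; -1; 0; 0; 0; 0; 0; 0; 0; 0; 0; 2; 0];
      [:: 1; -1; 1; 1; 1; 0; 0; 0; 0; 0; 0; 0; 0; 0; -2; 0];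
      [:: -1; 1; 0; 0; -1; 0; 0; 0; -1; 0; 0; 0; 1; 0; 1; 0];
      [:: -1; 1; -1; 0; -1; 0; -1; 1; 0; 0; 0; 0; 0; 1; 1; 0];
      [:: -1; 1; -1; 0; -2; -1; 0; 0; 0; 0; 1; 0; 0; 1; 2; 0];
      [:: 0; 0; 0; 0; -1; 0; 0; 0; 1; -1; 1; 0; 0; 0; 1; 0];
      [:: 1; -1; 1; -1; 1; 0; 0; 0; 0; 0; 0; 0; 0; 0; 0; 0];
      [:: -1; 1; 0; 0; -1; 0; 0; 0; 1; 0; 0; 0; -1; 0; 1; 0];
      [:: -1; 0; 0; 0; 1; 0; 0; -1; 0; 0; 0; 1; 0; 0; -1; 0];
      [:: 1; 0; 0; 0; 1; 0; 0; 1; 0; 0; 0; -1; 0; 0; -1; 0]]%Z.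

Definition tight_pent : seq nat :=
  [:: 0; 1; 2; 4; 8; 16; 256; 5; 9; 10; 48; 384; 112; 388; 448]%N.

Definition dual_pent : seq (seq Z) :=
   [:: [:: -2; -1; -1; -1; 0; -1; -1; 0; -1; -1; 0; -1; 0; 0; -1; 2];
      [:: 0; 0; 0; 0; 1; 1; 1; -1; 0; 0; -1; 0; 0; 0; -1; 0];
      [:: 0; 0; 0; 0; 1; 0; 0; 0; 1; 1; -1; 0; 0; 0; -1; 0];
      [:: 2; 1; 1; 0; -2; 0; 1; 0; 0; 0; 0; 1; 0; -1; 2; 0];
      [:: 1; 1; 1; 0; -1; 1; 0; 0; -1; 1; 0; 0; 0; -1; 1; 0];
      [:: -1; -1; -1; 1; 1; 0; 0; 0; 0; 0; 0; 0; 0; 0; 0; 0];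
      [:: 1; 0; 0; 0; 0; 0; 0; 0; 0; 0; 0; 0; 0; 0; 0; 0];
      [:: -1; -1; -1; 0; 1; 0; -1; 1; 0; 0; 0; 0; 0; 1; -1; 0];
      [:: -1; -1; -1; 0; 0; -1; 0; 0; 0; 0; 1; 0; 0; 1; 0; 0];
      [:: 0; 0; 0; 0; -1; 0; 0; 0; 1; -1; 1; 0; 0; 0; 1; 0];
      [:: 0; 0; 1; -1; 0; 0; 0; 0; 1; 0; 0; 0; -1; 0; 1; 0];
      [:: 0; 1; 0; 0; 0; 0; 0; -1; 1; 0; 0; 1; -1; 0; 0; 0];
      [:: 1; 1; 0; 0; -1; 0; 0; 0; -1; 0; 0; 0; 1; 0; 1; 0];
      [:: -1; 0; 0; 0; 1; 0; 0; 1; 0; 0; 0; -1; 0; 0; -1; 0];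
      [:: -1; -1; 0; 0; 1; 0; 0; 0; -1; 0; 0; 0; 1; 0; -1; 0]]%Z.

Definition tight_hex : seq nat :=
  [:: 0; 2; 4; 8; 16; 256; 9; 10; 272; 384; 13; 41; 388; 448; 57]%N.

Definition dual_hex : seq (seq Z) :=
   [:: [:: -1; 0; 1; -1; -1; -1; -1; 0; 0; -1; 0; -1; -1; 0; 0; 2];
      [:: 1; 1; 0; 0; 0; 0; 0; 0; 0; 1; -1; 0; 1; 0; 0; 0];
      [:: 0; -1; -1; 0; 0; 0; 1; 0; 0; 0; 0; 1; 0; -1; 0; 0];
      [:: 0; 0; -1; 0; 0; 1; 0; 0; -2; 1; 0; 0; 1; -1; 0; 0];
      [:: -1; -1; -1; 1; 1; 0; 0; 0; 0; 0; 0; 0; 0; 0; 0; 0];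
      [:: 1; -1; 0; 0; 1; 0; 0; 0; 1; 0; 0; 0; -1; 0; -1; 0];
      [:: -1; -1; -2; 0; 0; -1; 1; -1; -1; 0; 1; 0; 1; 0; 0; 0];
      [:: -1; -1; 0; 0; 0; 0; 0; 0; 2; -1; 1; 0; -1; 0; 0; 0];
      [:: 1; 1; 0; 0; -1; 0; 0; 0; -1; 0; 0; 0; 1; 0; 1; 0];
      [:: 0; 1; 0; 0; 0; 0; 0; -1; 1; 0; 0; 1; -1; 0; 0; 0];
      [:: 0; 0; 1; 0; 0; 0; -1; 1; 1; 0; 0; 0; -1; 1; 0; 0];
      [:: 0; 0; 1; 1; 0; 0; 0; 0; 1; 0; 0; 0; -1; 0; -1; 0];
      [:: 0; 1; 0; 0; 0; 0; 0; 1; -1; 0; 0; -1; 1; 0; 0; 0];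
      [:: 0; 0; 0; 0; 0; 0; 0; 0; -1; 0; 0; 0; 1; 0; 0; 0];
      [:: 0; 0; 1; -1; 0; 0; 0; 0; 1; 0; 0; 0; -1; 0; 1; 0]]%Z.

Definition tight_simp : seq nat :=
  [:: 0; 2; 66; 264; 265; 99; 198; 297; 396; 115; 454; 363; 462; 491; 495]%N.

Definition dual_simp : seq (seq Z) :=
   [:: [:: -1; -1; -1; -1; 0; -1; 1; -1; 0; 0; -1; -2; -2; -2; -1; 2];
      [:: 0; 0; 0; 0; 0; 0; 0; 0; 0; 0; 0; 0; 1; 0; 0; 0];
      [:: 0; 1; 1; 0; 0; 0; -1; 0; 0; 0; 0; 1; 0; 1; 0; 0];
      [:: 1; 0; 0; 0; 0; 1; -1; 0; 0; 0; 1; 1; 0; 0; 0; 0];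
      [:: -1; -1; -1; -1; 1; -1; 1; -1; 1; 1; -2; -2; -2; 0; -2; 0];
      [:: -1; -1; -1; 0; 0; 0; 1; -1; 1; 1; -1; -2; -2; -1; -2; 0];
      [:: 1; 0; 0; 0; -1; 0; 0; 1; 0; 0; 0; 1; 0; 0; 1; 0];
      [:: 0; 0; 1; 1; 0; 0; 0; 0; -1; 0; 0; 0; 1; 0; 1; 0];
      [:: 0; 1; 0; 0; 0; 0; 0; 1; -1; 0; 0; 1; 1; 0; 0; 0];
      [:: 0; 0; 0; 0; 0; 0; 0; 0; 0; 0; 0; 0; 0; 0; 1; 0];
      [:: 0; 0; 0; 0; 0; 0; 0; 0; 0; 0; 1; 0; 0; 0; 0; 0];
      [:: 1; 1; 0; 0; 0; 0; 0; 0; 0; -1; 1; 0; 1; 0; 0; 0];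
      [:: -1; -1; 0; -1; 1; 0; 1; -1; 1; 0; -2; -2; -1; -1; -2; 0];
      [:: 0; 0; 0; 0; 0; 0; 0; 0; 0; 0; 0; 1; 0; 0; 0; 0];
      [:: 0; 0; 0; 1; 0; 0; -1; 1; 0; 0; 0; 0; 0; 1; 1; 0]]%Z.

(** The nine binary digits of [k], most significant first, tell which of the vertices 0 to 8 lie in
    the set; the [tight] lists are read in this way. *)
Definition cut_index (k : nat) : seq bool := nth [::] (bitseqs 9) k.

(* The forms in dual are dual to the points of tight, which are thus affinely
   independent. *)
Definition facet_check (w : seq Z) (tight : seq nat) (dual : seq (seq Z)) : bool :=
  let T := [seq cutbits (cut_index k) | k <- tight] in
  [&& all (fun c => 0 <=? value w c)%Z cuts, has (fun c => ~~ (value w c =? 0)%Z) cuts,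
      all (fun c => value w c =? 0)%Z T,
      size T == 15, size dual == 15, all (fun v : seq Z => size v == 16) dual, size w == 16 &
      all (fun i => all (fun j => (value (nth [::] dual i) (nth [::] T j) =? 0)%Z == (i != j))
        (iota 0 15)) (iota 0 15)].

Lemma facet_checks :
  [&& facet_check w_edge tight_edge dual_edge, facet_check w_pent tight_pent dual_pent,
      facet_check w_hex tight_hex dual_hex & facet_check w_simp tight_simp dual_simp].
Proof. by vm_compute. Qed.

(** No other cut is tight, so the vertices of this facet are exactly the fifteen affinely
    independent points already certified. *)
Lemma simplex_check :
  all (fun c => (value w_simp c =? 0)%Z ==>
         (c \in [seq cutbits (cut_index k) | k <- tight_simp])) cuts.
Proof. by vm_compute. Qed.

Section FacetCheck.
Variable R : realFieldType.
Local Notation P := (cutp petersen R).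
Local Notation delta := (cut_vector petersen R).

Definition tight_point (tight : seq nat) (i : nat) :=
  delta (set_of (cut_index (nth 0%N tight i))).

Lemma lform_tight_point w tight i : size w = 16%N -> (i < size tight)%N ->
  @lform R w (tight_point tight i) =
  zr R (value w (nth [::] [seq cutbits (cut_index k) | k <- tight] i)).
Proof. by move=> w16 it; rewrite lform_cut // (nth_map 0%N). Qed.

(** Independence is stated for any [n] equal to 15 because it is used both with the cardinal of the
    edge type and with the numeral. *)
Lemma facet_checkP w tight dual : facet_check w tight dual ->
  [/\ forall x, P x -> 0 <= @lform R w x,
      is_facet P (face_by P (@lform R w)), full_dim P &
      forall n, n = 15%N -> aff_independent (fun i : 'I_n => tight_point tight i)].
Proof.
case/and5P=> ge0 /hasP[c c_cut wc] tight0 size_t /and4P[/eqP size_d /allP dual16 /eqP w16 dualP].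
rewrite size_map in size_t; have {}size_t := eqP size_t.
have valid := @valid_lform R w w16 ge0.
have tightE i : (i < 15)%N -> @lform R w (tight_point tight i) = 0.
  move=> i15; rewrite lform_tight_point ?size_t //; apply/eqP; rewrite zr_eq0.
  by apply: (allP tight0); rewrite mem_nth // size_map size_t.
have indep n : n = 15%N -> aff_independent (fun i : 'I_n => tight_point tight i).
  move=> n15 c' c0 cp0 i.
  have i15 : (i < 15)%N by rewrite -n15.
  have v16 : size (nth [::] dual i) = 16%N.
    by apply/eqP/dual16; rewrite mem_nth ?size_d.
  have valE (j : 'I_n) : (@lform R (nth [::] dual i) (tight_point tight j) == 0) = (i != j).
    have j15 : (j < 15)%N by rewrite -n15.
    rewrite lform_tight_point ?size_t // zr_eq0.
    have mem15 k : (k < 15)%N -> k \in iota 0 15 by rewrite mem_iota.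
    exact: (eqP (allP (allP dualP _ (mem15 _ i15)) _ (mem15 _ j15))).
  (* Evaluating the [i]-th dual form on the dependence isolates the coefficient [c' i]. *)
  have := affine_form_comb (fun e => zr R (nth 0%Z (nth [::] dual i) (ei e)))
    (zr R (nth 0%Z (nth [::] dual i) 15)) c' (fun i : 'I_n => tight_point tight i).
  rewrite cp0 c0 subr0 mul1r (bigD1 i) //= big1 => [|j /negbTE ji]; last first.
    by have := valE j; rewrite [i == j]eq_sym ji => /eqP lij; rewrite [X in _ * X]lij mulr0.
  rewrite addr0 /affine_form linear0 add0r -[X in X = _]add0r => /addIr/esym/eqP.
  by rewrite mulf_eq0 -/(affine_form _ _ _) [X in _ || X]valE eqxx orbF => /eqP.
have cutP S : P (delta S) by apply: sub_conv_hull; exists S.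
have [u _ cE] := mapP c_cut.
have [] := @is_facetI R _ P _ _ (fun i => tight_point tight i) (delta (set_of u)) valid
  (indep _ card_petersen_edge) (fun i => cutP _).
- by move=> i; apply: tightE; rewrite -card_petersen_edge.
- exact: cutP.
- by rewrite -/(@lform R w) lform_cut // zr_eq0 -cE.
by split.
Qed.

End FacetCheck.

(** * The four orbits *)

Lemma eqzsP s t : reflect (s = t) (eqzs s t).
Proof.
elim: s t => [|x s IH] [|y t]; apply: (iffP idP) => //=.
  by case: Z.eqb_spec => // -> /IH ->.
by case=> <- <-; rewrite Z.eqb_refl; apply/IH.
Qed.

Lemma has_eqzs x s : has (eqzs x) s = (x \in s).
Proof. by elim: s => //= y s ->; rewrite inE; congr (_ || _); apply/eqzsP/eqP. Qed.

Lemma dedupe_sub (T : eqType) (e : T -> T -> bool) s : {subset dedupe e s <= s}.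
Proof.
pose f acc x := if has (e x) acc then acc else x :: acc.
suff sub t acc : {subset t <= s} -> {subset acc <= s} -> {subset foldl f acc t <= s}.
  by apply: sub.
elim: t acc => //= x t IH acc ts accs; apply: IH => y.
  by move=> yt; apply: ts; rewrite inE yt orbT.
rewrite /f; case: ifP => _; first exact: accs.
by rewrite inE => /predU1P[->|/accs//]; apply: ts; rewrite mem_head.
Qed.

Lemma mem_dedupe (T : eqType) (e : rel T) s : e =2 eq_op -> dedupe e s =i s.
Proof.
move=> eE x; apply/idP/idP; first exact: dedupe_sub.
have hasE y (t : seq T) : has (e y) t = (y \in t).
  by rewrite (eq_has (eE y)); elim: t => //= z t IH; rewrite inE IH.
rewrite /dedupe -[x \in s]orbF -[false]/(x \in [::]).
elim: s [::] => [|y s IH] acc //= xs; apply: IH; move: xs; rewrite inE.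
case: eqVneq => [->|_] /=; rewrite hasE; case: ifP => yacc; rewrite ?mem_head ?orbT //.
  by rewrite yacc orbT.
by case/orP=> [->//|xacc]; rewrite inE xacc !orbT.
Qed.

Lemma mem_dedupe_eqzs s : dedupe eqzs s =i s.
Proof. by apply: mem_dedupe => x y; apply/eqzsP/eqP. Qed.

Fixpoint uniqz (s : seq (seq Z)) : bool :=
  if s is x :: s' then if has (eqzs x) s' then false else uniqz s' else true.

Lemma uniqzE s : uniqz s = uniq s.
Proof. by elim: s => //= x s ->; rewrite has_eqzs; case: (x \in s). Qed.

Definition orbit_check (w : seq Z) : bool :=
  let D := orbit_list w in all (fun s => has (eqzs (autz s w)) D) auts.

Lemma orbit_checks : all orbit_check bases.
Proof. by vm_compute. Qed.

Definition has_unit_coef (w : seq Z) : bool :=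
  (size w == 16) && has (fun x => Z.abs x =? 1)%Z w.

Lemma orbit_lists_check :
  [&& [seq size D | D <- orbit_lists] == [:: 30; 192; 320; 3072]%N,
      uniqz (flatten orbit_lists) & all has_unit_coef (flatten orbit_lists)].
Proof. by vm_compute. Qed.

Lemma mem_orbit_list w v : v \in orbit_list w -> exists s u,
  [/\ s \in auts, autz s w \in aut_types w & v = swz (cutbits u) (autz s w)].
Proof.
case/flattenP=> _ /mapP[v' v'w ->]; rewrite mem_dedupe_eqzs => /mapP[_ /mapP[u _ ->] ->].
have /mapP[s s_aut v'E] := dedupe_sub v'w.
exists s, u; split; first exact: s_aut.
  by rewrite -v'E.
by rewrite v'E.
Qed.

Section Orbits.
Variable R : realFieldType.
Local Notation RE := {ffun edge petersen -> R^o}.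
Local Notation P := (cutp petersen R).
Local Notation delta := (cut_vector petersen R).

Definition faces_of (D : seq (seq Z)) : set (set RE) :=
  [set face_by P (@lform R v) | v in [set v | v \in D]].

Lemma lform_switching_list v U : size v = 16%N ->
  exists2 u, u \in bitseqs 9 & @lform R v \o switching U = @lform R (swz (cutbits u) v).
Proof.
move=> v16; have [u u9 Uu] := cut_set_of U; exists u; first exact: u9.
by rewrite (switching_eq _ Uu); apply: lform_switching.
Qed.

Lemma orbit_list_form w v : v \in orbit_list w ->
  exists2 g, cut_symmetry g & @lform R v = @lform R w \o g.
Proof.
move=> /mem_orbit_list[s [u [/auts_sound[t tG <-] _ ->]]].
exists (aut_action t \o switching (set_of u)).
  by apply/cut_symmetryP; exists t, (set_of u).
rewrite compA (lform_aut_action _ _ tG) lform_switching; first exact: erefl.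
exact: size_autz.
Qed.

Lemma cut_orbit_list w : orbit_check w ->
  cut_orbit (face_by P (@lform R w)) = faces_of (orbit_list w).
Proof.
move=> /allP w_orbit; rewrite cut_orbit_face; apply/seteqP; split=> [F|F].
  move=> [g /cut_symmetryP[s [U [sG ->]]] <-].
  rewrite compA (lform_aut_action _ _ sG).
  (* The image under [s] may differ from the representative of its type, but it is a switching of
     that representative, and the two switchings merge into one. *)
  have := w_orbit _ (auts_complete sG); rewrite has_eqzs => /mem_orbit_list.
  case=> t [u [_ tw ->]].
  have t16 := size_autz t w; move: (autz t w) tw t16 => v vw v16.
  rewrite -lform_switching; last exact: v16.
  rewrite -compA.
  rewrite (_ : _ \o switching U = switching (symdiff (set_of u) U)); last first.
    by apply/funext => x; apply: switching_switching.
  have [u' u'9 ->] := lform_switching_list (symdiff (set_of u) U) v16.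
  exists (swz (cutbits u') v); last exact: erefl.
  apply/flattenP; exists (dedupe eqzs [seq swz c v | c <- cuts]).
    exact: (map_f (fun v => dedupe eqzs [seq swz c v | c <- cuts])).
  rewrite mem_dedupe_eqzs; apply: (map_f (fun c => swz c v)).
  exact: (map_f cutbits).
by move=> [v /= /orbit_list_form[g gS ->] <-]; exists g.
Qed.

Lemma affine_form_coef (w w' : edge petersen -> R) b b' t :
  (forall x, affine_form w' b' x = t * affine_form w b x) ->
  b' = t * b /\ forall e, w' e = t * w e.
Proof.
move=> H; have bE : b' = t * b.
  by have := H 0; rewrite /affine_form !linear0 !add0r.
split=> // e; have := H [ffun e' => (e' == e)%:R].
have coef (f : edge petersen -> R) : linear_form f [ffun e' => (e' == e)%:R] = f e.
  rewrite /linear_form (bigD1 e) //= big1 ?ffunE ?eqxx ?mulr1 ?addr0 // => e' /negbTE ne.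
  by rewrite ffunE ne mulr0.
by rewrite /affine_form !coef mulrDr bE => /addIr.
Qed.

Lemma zr_abs_ge1 z : z != 0%Z -> 1 <= `|zr R z|.
Proof.
move=> /eqP z0; have [z_ge0|z_lt0] := leP 0 (zr R z); [rewrite ger0_norm //|rewrite ltr0_norm //].
  by rewrite -subr_ge0 -(zr1 R) -zrB zr_ge0; move: z_ge0 z0; rewrite zr_ge0; lia.
rewrite -subr_ge0 -(zr1 R) -zrN -zrB zr_ge0; move: z_lt0 z0.
by rewrite -oppr_gt0 -zrN zr_gt0; lia.
Qed.

(* A form with a coefficient 1 or -1 cannot be t times an integral form with
   0 < t < 1. *)
Lemma lform_inj v v' : full_dim P -> has_unit_coef v -> has_unit_coef v' ->
  (forall x, P x -> 0 <= @lform R v x) -> (forall x, P x -> 0 <= @lform R v' x) ->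
  is_facet P (face_by P (@lform R v)) ->
  face_by P (@lform R v) = face_by P (@lform R v') -> v = v'.
Proof.
move=> fullP /andP[/eqP v16 v1] /andP[/eqP v'16 v'1] vP v'P vF vv'.
have [q Pq vq] := facet_nonzero fullP vF erefl.
have vF0 x : face_by P (@lform R v) x -> @lform R v x = 0 by case.
have vF0' x : face_by P (@lform R v) x -> @lform R v' x = 0 by rewrite vv' => -[].
have := facet_form_unique fullP vF vF0 vF0' vq.
set t := _ / _ => H.
have t_ge0 : 0 <= t by apply: divr_ge0; [apply: v'P|apply: vP].
have [bE wE] := affine_form_coef H.
have coef i : zr R (nth 0%Z v' i) = t * zr R (nth 0%Z v i).
  have [i15|] := ltnP i 15.
    by have := wE (ed (Ordinal i15)); rewrite edK.
  rewrite leq_eqVlt => /predU1P[<-//|i16].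
  by rewrite !nth_default ?v16 ?v'16 // mulr0.
(* A coefficient 1 or -1 of [v'] is t times a nonzero integer, so t <= 1; one of [v] makes t the
   absolute value of an integer. *)
have t1 : t = 1.
  apply/eqP; rewrite eq_le; apply/andP; split.
    have /(has_nthP 0%Z)[i _ /Z.eqb_eq v'i] := v'1.
    have := congr1 Num.norm (coef i); rewrite normrM (ger0_norm t_ge0).
    have -> : `|zr R (nth 0%Z v' i)| = 1.
      have [->|->] : (nth 0 v' i = 1 \/ nth 0 v' i = -1)%Z by lia.
        by rewrite zr1 normr1.
      by rewrite -[(-1)%Z]/(Z.opp 1) zrN zr1 normrN1.
    move=> E; have vi : nth 0%Z v i != 0%Z.
      by apply: contra_eq_neq E => ->; rewrite zr0 normr0 mulr0 oner_eq0.
    by rewrite E ler_peMr // zr_abs_ge1.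
  have /(has_nthP 0%Z)[i _ /Z.eqb_eq vi] := v1.
  have := congr1 Num.norm (coef i); rewrite normrM (ger0_norm t_ge0).
  have -> : `|zr R (nth 0%Z v i)| = 1.
    have [->|->] : (nth 0 v i = 1 \/ nth 0 v i = -1)%Z by lia.
      by rewrite zr1 normr1.
    by rewrite -[(-1)%Z]/(Z.opp 1) zrN zr1 normrN1.
  rewrite mulr1 => <-; apply: zr_abs_ge1; apply/eqP => v'i.
  (* A zero coefficient [v'_i] would force t = 0, and the form of [v'] would vanish on the whole
     polytope. *)
  have [q' Pq' v'q] : exists2 q', P q' & @lform R v' q' != 0.
    by apply: (facet_nonzero fullP _ vv'); exact: vF.
  have vi0 : zr R (nth 0%Z v i) != 0 by rewrite zr_eq0; lia.
  have /eqP := coef i; rewrite v'i zr0 eq_sym mulf_eq0 (negbTE vi0) orbF => /eqP t0.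
  by move: v'q; rewrite /lform H t0 mul0r eqxx.
apply: (@eq_from_nth _ 0%Z) => [|i _]; first by rewrite v16 v'16.
have := coef i; rewrite t1 mul1r => /eqP.
by rewrite -subr_eq0 -zrB zr_eq0 => /Z.eqb_eq; lia.
Qed.

End Orbits.

(** * Completeness of the list of facets *)

Lemma class_checks : all class_check class_reps.
Proof. by vm_compute. Qed.

Lemma reduction_check :
  all (fun k => has (fun s => canon (autbits s k) \in class_reps) auts) off_tree.
Proof. by vm_compute. Qed.

Lemma size_xorb2 k u : size k = 15%N -> size (xorb2 k (cutbits u)) = 15%N.
Proof. by move=> k15; rewrite size_map size_zip k15 size_cutbits. Qed.

Lemma nth_xorb2 k u i : size k = 15%N -> (i < 15)%N ->
  nth false (xorb2 k (cutbits u)) i = nth false k i (+) nth false (cutbits u) i.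
Proof.
have u15 := size_cutbits u; move: (cutbits u) u15 => c c15 k15 i15.
by rewrite (nth_map (false, false)) ?size_zip ?k15 ?c15 // nth_zip ?k15 ?c15.
Qed.

Lemma size_canon k : size k = 15%N -> size (canon k) = 15%N.
Proof. exact: size_xorb2. Qed.

Lemma canon_off_tree k : size k = 15%N -> canon k \in off_tree.
Proof.
case: k => [|k0 [|k1 [|k2 [|k3 [|k4 [|k5 [|k6 [|k7 [|k8 [|k9 [|k10 [|k11 [|k12 [|k13 [|k14 []]]]]]]]]]]]]]]] // _.
rewrite /canon /potential /xorb2 /cutbits /= !addKb !addbb.
set b4 := k4 (+) _; set b5 := k5 (+) _; set b6 := k6 (+) _.
set b7 := k7 (+) _; set b8 := k8 (+) _; set b9 := k9 (+) _.
apply/mapP; exists [:: b4; b5; b6; b7; b8; b9]; last by [].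
by rewrite mem_bitseqs.
Qed.

Notation weight_index := (widen_ord (isT : (15 <= 16)%N)).

Section Completeness.
Variable R : realFieldType.
Local Notation RE := {ffun edge petersen -> R^o}.
Local Notation P := (cutp petersen R).
Local Notation delta := (cut_vector petersen R).
Implicit Types (k : seq bool) (w : edge petersen -> R).

Definition compatible k w :=
  forall i : 'I_15, if nth false k i then w (ed i) <= 0 else 0 <= w (ed i).

(** A switching reverses the signs of the coefficients on the cut, hence adds the cut to [k] modulo
    2: sign patterns up to switching are classes modulo cuts. *)
Lemma compatible_switching k w b u : size k = 15%N -> compatible k w ->
  exists w' b', affine_form w b \o switching (set_of u) = affine_form w' b' /\
    compatible (xorb2 k (cutbits u)) w'.
Proof.
move=> k15 kw; rewrite affine_form_switching; do 2!eexists; split; first by [].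
move=> i; have := kw i; rewrite nth_xorb2; [|exact: k15|exact: ltn_ord].
rewrite crosses_set_of; case: (nth false k i); case: (nth false _ i) => /=.
all: by rewrite ?oppr_ge0 ?oppr_le0.
Qed.

Lemma compatible_aut k w b s : automorphism petersen s -> compatible k w ->
  exists w' b', affine_form w b \o aut_action s = affine_form w' b' /\
    compatible (autbits (perm_bits s) k) w'.
Proof.
move=> sG kw; rewrite (affine_form_aut_action _ _ sG); do 2!eexists; split; first by [].
move=> i; rewrite /autbits (nth_map 0%N); last by rewrite size_iota.
rewrite nth_iota; last exact: ltn_ord.
rewrite add0n; have [j -> ->] := aut_edgeV_ed i sG.
exact: kw.
Qed.

Lemma class_reduction k w b : size k = 15%N -> compatible k w ->
  exists g w' b', [/\ cut_symmetry g, affine_form w b \o g = affine_form w' b' &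
    exists2 r, r \in class_reps & compatible r w'].
Proof.
move=> k15 kw.
have [w1 [b1 [E1 kw1]]] := compatible_switching b (potential k) k15 kw.
have /hasP[l /auts_sound[s sG <-] rep] := allP reduction_check _ (canon_off_tree k15).
have [w2 [b2 [E2 kw2]]] := compatible_aut b1 sG kw1.
set k2 := autbits _ _ in kw2 rep.
have k2_15 : size k2 = 15%N by rewrite size_map size_iota.
(* The automorphism may move the pattern off its canonical member, so a second switching makes it
   vanish on the tree again. *)
have [w3 [b3 [E3 kw3]]] := compatible_switching b2 (potential k2) k2_15 kw2.
exists ((switching (set_of (potential k)) \o aut_action s) \o switching (set_of (potential k2))).
exists w3, b3; split; last by exists (canon k2).
- do 2?apply: CutSymComp; try exact: CutSymSwitching; exact: CutSymAut.
- by rewrite -[LHS]/(((affine_form w b \o switching _) \o aut_action s) \o switching _) E1 E2 E3.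
Qed.

(* The form sum_e c_e z_e - c_15, where z_e is 1 - x_e on the edges of k and
   x_e elsewhere. *)
Definition class_form k (c : 'rV[R]_16) : RE -> R :=
  affine_form (fun e => let i := weight_index (ei e) in
                 if nth false k i then - c 0 i else c 0 i)
    (\sum_(i < 15) (nth false k i)%:R * c 0 (weight_index i) - c 0 ord_max).

Lemma class_form_of k w b : compatible k w ->
  exists2 c : 'rV[R]_16, forall i : 'I_15, 0 <= c 0 (weight_index i) &
    affine_form w b = class_form k c.
Proof.
move=> kw.
(* The substitutions 1 - x_e on [k] contribute the constant [c0], so a total constant [b] leaves the
   bound c0 - b as last coordinate. *)
pose c0 := \sum_(i < 15) (nth false k i)%:R * `|w (ed i)|.
pose c : 'rV[R]_16 := \row_i (if insub (i : nat) is Some j then `|w (ed j)| else c0 - b).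
have cE (i : 'I_15) : c 0 (weight_index i) = `|w (ed i)|.
  by rewrite mxE /= insubT ?ltn_ord // => i15; congr (`|w (ed _)|); apply: val_inj.
exists c => [i|]; first by rewrite cE normr_ge0.
apply: eq_affine_form => [e|].
  rewrite /= cE eiK; have := kw (ei e); rewrite eiK.
  by case: (nth false k _) => we; [rewrite ler0_norm ?opprK|rewrite ger0_norm].
have -> : c 0 ord_max = c0 - b by rewrite mxE /= insubF.
under eq_bigr do rewrite cE.
by rewrite -/c0 opprB addrC subrK.
Qed.

Lemma size_member_cons k : size k = 15%N -> size (member_cons k) = 16%N.
Proof. by move=> k15; rewrite size_rcons size_map k15. Qed.

Lemma zv_member_cons k (i : 'I_16) : size k = 15%N ->
  zv R 16 (member_cons k) 0 i = if (i < 15)%N then (nth false k i)%:R else -1.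
Proof.
move=> k15; rewrite mxE /member_cons nth_rcons size_map k15; case: ltnP => i15.
  by rewrite (nth_map false) ?k15 //; case: nth.
by rewrite (_ : _ == _) //= eqn_leq i15 -ltnS ltn_ord.
Qed.

(** At a cut, z_e is 1 exactly on the sum modulo 2 of [k] and the cut. The value of the form is
    therefore the weight of a member of the class less the bound, and validity becomes one linear
    condition on [c] for each member. *)
Lemma class_form_cut k c u : size k = 15%N ->
  class_form k c (delta (set_of u)) = dotp (zv R 16 (member_cons (xorb2 k (cutbits u)))) c.
Proof.
move=> k15; have m15 := size_xorb2 u k15.
have mE (i : 'I_15) := nth_xorb2 u k15 (ltn_ord i).
have uE := crosses_set_of u.
move: (cutbits u) (xorb2 k _) m15 mE uE => v m m15 mE uE.
rewrite /class_form /affine_form /linear_form sum_ed addrA -big_split.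
rewrite /dotp [in RHS]big_ord_recr zv_member_cons // ltnn mulN1r; congr (_ - _).
apply: eq_bigr => i _; rewrite zv_member_cons // [in RHS]ifT; last exact: (ltn_ord i).
rewrite /= mE edK ffunE uE (_ : widen_ord _ i = widen_ord (leqnSn 15) i); last exact: val_inj.
by case: (nth false k i); case: (nth false v i);
  rewrite /= ?mulr1 ?mulr0 ?mul1r ?mul0r ?addr0 ?add0r ?addNr.
Qed.

End Completeness.

Definition edge_forms_in (D : seq (seq Z)) : bool :=
  all (fun j => has (eqzs (edge_form false j)) D && has (eqzs (edge_form true j)) D) (iota 0 15).

Lemma edge_forms_check : edge_forms_in (orbit_list w_edge).
Proof. by vm_compute. Qed.

Lemma edge_form_orbit b j : (j < 15)%N -> edge_form b j \in orbit_list w_edge.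
Proof.
have := edge_forms_check; move: (orbit_list w_edge) => D /allP check j15.
have /check : j \in iota 0 15 by rewrite mem_iota.
by rewrite !has_eqzs => /andP[ej0 ej1]; case: b.
Qed.

Lemma crosses_set1 (x : petersen_vertex) (e : edge petersen) :
  crosses [set x]%SET e = (x \in val e).
Proof.
have [u [v [_ uv eE]]] := edgeP e.
rewrite (crossesE _ uv eE) eE !inE [x == u]eq_sym [x == v]eq_sym.
by case: (eqVneq u x) => [<-|_]; rewrite //= eq_sym (negbTE uv).
Qed.

Section ClassFacets.
Variable R : realFieldType.
Local Notation RE := {ffun edge petersen -> R^o}.
Local Notation P := (cutp petersen R).
Local Notation delta := (cut_vector petersen R).
Implicit Types (k : seq bool) (c : 'rV[R]_16).

Lemma lform_edge_form b (j : 'I_15) x :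
  @lform R (edge_form b j) x = if b then 1 - x (ed j) else x (ed j).
Proof.
rewrite lformE /edge_form (nth_rcons_last _ _ (n := 15)); last by rewrite size_map size_iota.
have nthE (i : 'I_15) : nth 0%Z (rcons [seq if l == j :> nat then if b then (-1)%Z else 1%Z
    else 0%Z | l <- iota 0 15] (zbit b)) i = if i == j then if b then (-1)%Z else 1%Z else 0%Z.
  rewrite nth_rcons size_map size_iota ltn_ord (nth_map 0%N) ?size_iota ?ltn_ord //.
  by rewrite nth_iota ?ltn_ord.
rewrite (bigD1 j) ?big1 ?addr0 => [|i /negbTE ij|//]; last by rewrite nthE ij mul0r.
rewrite nthE eqxx {nthE} /= addr0.
case: b; last by rewrite [zr _ _]zr1 mul1r [X in _ + X]zr0 addr0.
by rewrite -[(-1)%Z]/(Z.opp 1) zrN [zbit _]/= zr1 mulN1r addrC.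
Qed.

Lemma delta_set_of S : exists2 u, u \in bitseqs 9 & delta S = delta (set_of u).
Proof.
have [u u9 Su] := cut_set_of S; exists u; first exact: u9.
by apply/ffunP => e; rewrite !ffunE Su.
Qed.

Lemma delta_cutp S : P (delta S).
Proof. by apply: sub_conv_hull; exists S. Qed.

(** If z_j were 1 at a tight cut, moving [v] to the other side would remove [j] and at worst add the
    two other edges at [v]. The weight would drop strictly below the bound. *)
Lemma star_violated k c v (j : 'I_15) u : size k = 15%N ->
  (forall i : 'I_15, 0 <= c 0 (weight_index i)) ->
  (forall x, P x -> 0 <= class_form k c x) ->
  (v < 10)%N -> incident v j -> dotp (zv R 16 (star_vec v j)) c < 0 ->
  class_form k c (delta (set_of u)) = 0 ->
  nth false (xorb2 k (cutbits u)) j = false.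
Proof.
move=> k15 c_ge0 valid v10 vj star_lt0 tight; apply/negP => mj.
pose u' := bits_of (symdiff (set_of u) [set vertex v]%SET).
have := valid _ (delta_cutp (set_of u')); move: tight.
rewrite !class_form_cut //.
have mE (i : 'I_15) : nth false (xorb2 k (cutbits u')) i =
    nth false (xorb2 k (cutbits u)) i (+) incident v i.
  rewrite !nth_xorb2 ?ltn_ord // -!crosses_set_of bits_ofK crosses_symdiff crosses_set1.
  by rewrite mem_ed // addbA.
have m15 := size_xorb2 u k15; have m'15 := size_xorb2 u' k15.
move: (xorb2 k (cutbits u)) (xorb2 k (cutbits u')) m15 m'15 mE mj => m m' m15 m'15 mE mj m0.
suff le : dotp (zv R 16 (member_cons m')) c <=
    dotp (zv R 16 (member_cons m)) c + dotp (zv R 16 (star_vec v j)) c.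
  by move=> /le_trans/(_ le); rewrite m0 add0r leNgt star_lt0.
rewrite /dotp -big_split; apply: ler_sum => i _.
rewrite /= -mulrDl !zv_member_cons // mxE /star_vec nth_rcons size_map size_iota.
have [i15|i15] := ltnP i 15; last first.
  by rewrite (_ : _ == _) ?addr0 // eqn_leq i15 -ltnS ltn_ord.
have -> : i = weight_index (Ordinal i15) by exact: val_inj.
apply: ler_wpM2r; first exact: c_ge0.
move: (Ordinal i15) => {i15}i; rewrite -[nat_of_ord (widen_ord _ i)]/(nat_of_ord i).
rewrite (nth_map 0%N); last by rewrite size_iota.
rewrite nth_iota; last exact: ltn_ord.
rewrite add0n mE.
case: (eqVneq (i : nat) j) => [->|_].
  by rewrite mj vj -[(-1)%Z]/(Z.opp 1) zrN zr1 subrr.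
by case: (incident v i); case: (nth false m i); rewrite /= ?zr1 ?zr0 ?addr0 ?add0r ?addr_ge0.
Qed.

End ClassFacets.

Lemma w_edge_base : w_edge \in bases.
Proof. by rewrite /bases mem_head. Qed.

Lemma mem_orbit_lists_base w : w \in bases -> orbit_list w \in orbit_lists.
Proof. by move=> wb; apply: map_f. Qed.

Lemma orbit_listsI w v : w \in bases -> v \in orbit_list w -> v \in flatten orbit_lists.
Proof.
move=> wb vw; apply/flattenP; exists (orbit_list w); last exact: vw.
exact: mem_orbit_lists_base.
Qed.

Lemma mem_orbit_lists v : v \in flatten orbit_lists -> exists2 w, w \in bases & v \in orbit_list w.
Proof. by case/flattenP=> _ /mapP[w wb ->] vw; exists w. Qed.

Lemma class_checkP k : class_check k ->
  exists2 L, cone_rays 16 (unit_vectors 16) (orthant_rays 16) (class_cons k) = Some L &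
    forall r, r \in L ->
      (forall c, c \in cuts -> (0 <= dotz (member_cons (xorb2 k c)) r.1)%Z) /\
      exists2 v, v \in flatten orbit_lists &
        forall c, c \in cuts -> dotz (member_cons (xorb2 k c)) r.1 = 0%Z -> value v c = 0%Z.
Proof.
rewrite /class_check; case: cone_rays => [L /allP L_ok|]; last by [].
exists L; first by [].
move=> r /L_ok; rewrite /ray_check; case: ifP => [/allP r_ge0|]; last by [].
case/hasP=> v; rewrite mem_filter => /andP[_ v_orbit] /allP v0.
split=> [c c_cut|].
  by apply/Z.leb_le; apply: r_ge0 (map_f (fun c => (c, _)) c_cut).
exists v; first exact: v_orbit.
move=> c c_cut rc; apply/Z.eqb_eq/v0.
apply/mapP; exists (c, 0%Z); last by [].
rewrite mem_filter andTb; apply/mapP; exists c; first exact: c_cut.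
by rewrite rc.
Qed.

Lemma mem_star_cons a : a \in star_cons -> exists v (j : 'I_15),
  [/\ (v < 10)%N, incident v j & a = star_vec v j].
Proof.
case/flattenP=> _ /mapP[v v10 ->] /mapP[j]; rewrite mem_filter => /andP[vj j15] ->.
rewrite mem_iota add0n in j15; rewrite mem_iota add0n in v10.
by exists v, (Ordinal (j15 : (j < 15)%N)).
Qed.

Lemma mem_class_cons k a : a \in class_cons k ->
  a \in star_cons \/ exists2 c, c \in cuts & a = member_cons (xorb2 k c).
Proof.
rewrite mem_cat => /orP[|/flattenP[_ /mapP[i _ ->] /mapP[m + ->]]]; first by left.
rewrite !mem_filter => /andP[_ /andP[_ /mapP[c c_cut ->]]]; right.
by exists c.
Qed.

Lemma size_class_cons k : size k = 15%N -> all (fun a : seq Z => size a <= 16)%N (class_cons k).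
Proof.
move=> k15; apply/allP => a /mem_class_cons[/mem_star_cons[v [j [_ _ ->]]]|].
  by rewrite size_rcons size_map size_iota.
case=> _ /mapP[u _ ->] ->; rewrite size_member_cons; first by [].
exact: size_xorb2.
Qed.

Lemma size_class_reps k : k \in class_reps -> size k = 15%N.
Proof.
by case/mapP=> s _ ->; apply: size_canon; rewrite size_map size_iota.
Qed.

Lemma orbit_lists_facts :
  [/\ [seq size D | D <- orbit_lists] = [:: 30; 192; 320; 3072]%N,
      uniq (flatten orbit_lists) & {in flatten orbit_lists, forall v, has_unit_coef v}].
Proof.
have /and3P[/eqP sizes] := orbit_lists_check; rewrite uniqzE => uniq_all /allP units.
by split; [exact: sizes|exact: uniq_all|exact: units].
Qed.

Lemma size_orbit_list i : (i < 4)%N ->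
  size (orbit_list (nth [::] bases i)) = nth 0%N [:: 30; 192; 320; 3072]%N i.
Proof.
case: orbit_lists_facts => <- _ _ i4.
rewrite /orbit_lists (nth_map [::]); last by rewrite size_map.
by rewrite (nth_map [::]); last exact: i4.
Qed.

Opaque orbit_list orbit_lists auts cuts class_reps star_cons class_cons.

Section FacetList.
Variable R : realFieldType.
Local Notation RE := {ffun edge petersen -> R^o}.
Local Notation P := (cutp petersen R).
Local Notation delta := (cut_vector petersen R).
Implicit Types (k : seq bool) (c : 'rV[R]_16) (F : set RE).

Lemma petersen_full_dim : full_dim P.
Proof.
have /andP[H _] := facet_checks.
by case: (facet_checkP R H) => _ _ full _; exact: full.
Qed.

Lemma base_facet w : w \in bases ->
  (forall x, P x -> 0 <= @lform R w x) /\ is_facet P (face_by P (@lform R w)).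
Proof.
have /and4P[H1 H2 H3 H4] := facet_checks.
rewrite !inE => /or4P[] /eqP ->.
- by case: (facet_checkP R H1) => ge0 fac _ _; split; [exact: ge0|exact: fac].
- by case: (facet_checkP R H2) => ge0 fac _ _; split; [exact: ge0|exact: fac].
- by case: (facet_checkP R H3) => ge0 fac _ _; split; [exact: ge0|exact: fac].
- by case: (facet_checkP R H4) => ge0 fac _ _; split; [exact: ge0|exact: fac].
Qed.

Lemma orbit_facet v : v \in flatten orbit_lists ->
  (forall x, P x -> 0 <= @lform R v x) /\ is_facet P (face_by P (@lform R v)).
Proof.
case/mem_orbit_lists=> w /base_facet[w_ge0 wF] /(@orbit_list_form R)[g gS ->].
have [h hS gh] := cut_symmetry_iso gS; split.
  by have [_ _ _ _ [gP _]] := gh; move=> x /gP/w_ge0.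
have -> : face_by P (@lform R w \o g) = h @` face_by P (@lform R w).
  by rewrite (image_face_by (affine_isoC gh)).
exact: cut_symmetry_facet.
Qed.

Lemma facet_sub_orbit F v : is_facet P F -> v \in flatten orbit_lists ->
  F `<=` face_by P (@lform R v) -> F = face_by P (@lform R v).
Proof.
move=> FF /orbit_facet[_ vF] Fv.
have [q Pq vq] := facet_nonzero petersen_full_dim vF erefl.
exact: facet_sub_face petersen_full_dim FF Pq vq Fv.
Qed.

Lemma class_facet k c : k \in class_reps ->
  (forall i : 'I_15, 0 <= c 0 (weight_index i)) ->
  (forall x, P x -> 0 <= class_form k c x) ->
  is_facet P (face_by P (class_form k c)) ->
  exists2 v, v \in flatten orbit_lists &
    face_by P (class_form k c) = face_by P (@lform R v).
Proof.
move=> k_rep c_ge0 valid FF; have k15 := size_class_reps k_rep.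
have [L raysE L_ok] := class_checkP (allP class_checks _ k_rep).
have {k_rep raysE} cone := @conic_comb_cone_rays R 16 _ _ (size_class_cons k15) raysE.
have range_ge0 x : range delta x -> 0 <= class_form k c x.
  by case=> S _ <-; apply: valid; apply: delta_cutp.
(* Enough to find a listed form vanishing at the tight cuts: these generate the face, and facets are
   maximal. *)
have contained v : v \in flatten orbit_lists ->
    (forall u, u \in bitseqs 9 -> class_form k c (delta (set_of u)) = 0 ->
       @lform R v (delta (set_of u)) = 0) ->
    exists2 v, v \in flatten orbit_lists &
      face_by P (class_form k c) = face_by P (@lform R v).
  move=> vo tight_v; exists v; first exact: vo.
  apply: facet_sub_orbit FF vo _ => x [Px fx]; split; first exact: Px.
  apply: (conv_hull_vanish range_ge0 _ Px fx) => _ [S _ <-].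
  by have [u u9 ->] := delta_set_of R S; apply: tight_v.
(* A violated triangle inequality puts the face inside the edge facet z_j = 0, whose form depends on
   whether [j] belongs to [k]. *)
have [star|] := boolP (all (fun a => 0 <= dotp (zv R 16 a) c) star_cons); last first.
  rewrite -has_predC => /hasP[_ /mem_star_cons[v [j [v10 vj ->]]]].
  rewrite /= -ltNge => star_lt0.
  apply: (contained (edge_form (nth false k j) j)).
    exact: (orbit_listsI w_edge_base (edge_form_orbit _ (ltn_ord j))).
  move=> u _ tight; have := star_violated k15 c_ge0 valid v10 vj star_lt0 tight.
  rewrite nth_xorb2 // lform_edge_form ffunE crosses_set_of.
  by case: (nth false k j); case: (nth false _ j) => //= _; rewrite subrr.
have cutE u := class_form_cut c u k15.
have [u1 u1_9 nontight] : exists2 u, u \in bitseqs 9 & class_form k c (delta (set_of u)) != 0.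
  have [q Pq fq] := facet_nonzero petersen_full_dim FF erefl.
  apply: contrapT => none.
  (* With the zero form as first form, [conv_hull_vanish] says that a form vanishing at all cuts
     vanishes on the polytope. *)
  have zero (x : RE) : affine_form (fun=> 0 : R) 0 x = 0.
    by rewrite /affine_form /linear_form addr0 big1 // => e _; rewrite mul0r.
  have range_zero x : range delta x -> 0 <= affine_form (fun=> 0 : R) 0 x by rewrite zero.
  suff range_f x : range delta x -> affine_form (fun=> 0 : R) 0 x = 0 -> class_form k c x = 0.
    by have := conv_hull_vanish range_zero range_f Pq (zero q); move/eqP: fq.
  case=> S _ <- _; have [u u9 ->] := delta_set_of R S.
  by apply/eqP/negPn/negP => fu; apply: none; exists u.
have dotp_ge0 u : 0 <= dotp (zv R 16 (member_cons (xorb2 k (cutbits u)))) c.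
  by rewrite -cutE; apply/valid/delta_cutp.
have zvE m r : size m = 15%N -> dotp (zv R 16 (member_cons m)) (zv R 16 r) = zr R (dotz (member_cons m) r).
  by move=> m15; rewrite dotp_zv // size_member_cons.
(* The orthant includes the bound as a coordinate. A negative bound would make the form positive at
   every cut and the face empty. *)
have c15 : 0 <= c 0 ord_max.
  rewrite leNgt; apply/negP => c_lt0.
  have pos u : 0 < class_form k c (delta (set_of u)).
    rewrite cutE; have := size_xorb2 u k15; move: (xorb2 k _) => m m15.
    rewrite /dotp big_ord_recr zv_member_cons // ltnn mulN1r ltr_wpDl ?oppr_gt0 //.
    apply: sumr_ge0 => i _; rewrite zv_member_cons // [X in (if X then _ else _) * _](ltn_ord i).
    apply: mulr_ge0; first exact: ler0n.
    by rewrite (_ : widen_ord _ i = weight_index i) ?c_ge0 //; apply: val_inj.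
  have [p [_ Fp]] := facet_points petersen_full_dim FF.
  have lt0 : (0 < #|{: edge petersen}|)%N by rewrite card_petersen_edge.
  have [Pp fp] := Fp (Ordinal lt0).
  suff range_f x : range delta x -> class_form k c x = 0 ->
      affine_form (fun=> 0 : R) 1 x = 0.
    have := conv_hull_vanish range_ge0 range_f Pp fp => /eqP.
    rewrite /affine_form /linear_form big1 ?add0r ?oner_eq0 // => e _.
    by rewrite mul0r.
  case=> S _ <-; have [u _ ->] := delta_set_of R S.
  by move/eqP; rewrite gt_eqF.
have combc : conic_comb [seq zv R 16 r.1 | r <- L] c.
  apply: cone => [i|a].
    have [i15|i15] := ltnP i 15.
      by rewrite (_ : i = weight_index (Ordinal i15)) ?c_ge0 //; apply: val_inj.
    rewrite (_ : i = ord_max) //; apply: val_inj; apply/eqP.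
    by rewrite eqn_leq i15 -ltnS ltn_ord.
  case/mem_class_cons=> [|[_ /mapP[u _ ->] ->]]; [exact: (allP star)|exact: dotp_ge0].
(* The functionals of the tight cuts: nonnegative on all rays and zero at [c], hence zero on a ray
   occurring in [c]. A ray positive at the slack cut [u1] must occur. *)
pose H a := exists u, [/\ u \in bitseqs 9, class_form k c (delta (set_of u)) = 0 &
  a = zv R 16 (member_cons (xorb2 k (cutbits u)))].
have [_ /mapP[r rL ->] [_ rH]] : exists2 r, r \in [seq zv R 16 r.1 | r <- L] &
    0 < dotp (zv R 16 (member_cons (xorb2 k (cutbits u1)))) r /\
    (forall a, H a -> dotp a r = 0).
  apply: (proj1 (conic_comb_ray _ _ combc _)).
  - move=> _ _ [u [u9 _ ->]] /mapP[r rL ->]; rewrite zvE; last exact: size_xorb2.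
    by rewrite zr_ge0; apply/Z.leb_le/(L_ok r rL).1/map_f.
  - by move=> _ [u [_ tight ->]]; rewrite -cutE.
  - by rewrite -cutE lt0r nontight; apply/valid/delta_cutp.
have [_ [v vo v_tight]] := L_ok r rL.
apply: (contained v vo) => u u9 tight.
have /eqP := rH _ (ex_intro _ u (And3 u9 tight erefl)).
rewrite zvE; last exact: size_xorb2.
rewrite zr_eq0 => /Z.eqb_eq rc.
rewrite lform_cut; last first.
  have [w _ /mem_orbit_list[s [u' [_ _ ->]]]] := mem_orbit_lists vo.
  by apply: size_swz; [exact: size_cutbits|exact: size_autz].
by rewrite (v_tight _ (map_f cutbits u9) rc).
Qed.

End FacetList.

(** * Counting the facets and the orbits *)

Lemma image_seq_card (T : Type) (S : eqType) (x0 : S) (s : seq S) (f : S -> T) : uniq s ->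
  {in s &, injective f} -> f @` [set x | x \in s] #= `I_(size s).
Proof.
move=> s_uniq f_inj.
have -> : f @` [set x | x \in s] = (fun i => f (nth x0 s i)) @` `I_(size s).
  apply/seteqP; split=> [_ [x xs <-]|_ [i it <-]].
    by exists (index x s); rewrite /= ?index_mem ?nth_index.
  by exists (nth x0 s i); rewrite //= mem_nth.
apply: inj_card_eq => i j; rewrite !inE /= => it jt /f_inj.
by rewrite !mem_nth // => /(_ isT isT)/eqP; rewrite nth_uniq // => /eqP.
Qed.

Lemma uniq_flatten_mem (T : eqType) (L : seq (seq T)) D :
  uniq (flatten L) -> D \in L -> uniq D.
Proof.
elim: L => //= D' L IH; rewrite cat_uniq inE => /and3P[D'_uniq _ L_uniq].
by case/predU1P=> [->|/IH]; [|apply].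
Qed.

Section FacetCount.
Variable R : realFieldType.
Local Notation RE := {ffun edge petersen -> R^o}.
Local Notation P := (cutp petersen R).

Lemma faces_of_card D : uniq D -> {subset D <= flatten orbit_lists} ->
  @faces_of R D #= `I_(size D).
Proof.
move=> D_uniq D_sub; apply: (image_seq_card [::]) => // v v' /D_sub vo /D_sub v'o.
have [_ _ units] := orbit_lists_facts.
have [v_ge0 vF] := orbit_facet R vo; have [v'_ge0 _] := orbit_facet R v'o.
exact: (lform_inj (petersen_full_dim R) (units _ vo) (units _ v'o) v_ge0 v'_ge0 vF).
Qed.

Lemma base_orbit w : w \in bases ->
  cut_orbit (face_by P (@lform R w)) = @faces_of R (orbit_list w).
Proof. by move=> wb; apply/cut_orbit_list/(allP orbit_checks). Qed.

Lemma facetsE : facets P = @faces_of R (flatten orbit_lists).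
Proof.
apply/seteqP; split=> [F FF|_ [v vo <-]]; last exact: (orbit_facet R vo).2.
have [/is_faceP[w [b [valid FE]]] _] := FF.
(* The sign pattern of the form; zero coefficients fit either sign and are put outside [k]. *)
pose k := [seq w (ed (inord i)) < 0 | i <- iota 0 15].
have k15 : size k = 15%N by rewrite size_map size_iota.
have kw : compatible k w.
  move=> i; rewrite (nth_map 0%N); last by rewrite size_iota.
  rewrite nth_iota ?ltn_ord // add0n inord_val.
  by case: ltP => [/ltW|].
have [g [w' [b' [gS gE [r r_rep rw]]]]] := class_reduction b k15 kw.
have [c c_ge0 cE] := class_form_of b' rw.
have [h hS gh] := cut_symmetry_iso gS.
have hF : h @` F = face_by P (class_form r c).
  by rewrite FE (image_face_by (affine_isoC gh)) gE cE.
have FF' : is_facet P (face_by P (class_form r c)).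
  by rewrite -hF; apply: cut_symmetry_facet.
have valid' x : P x -> 0 <= class_form r c x.
  rewrite -cE -gE => Px; apply: valid.
  by have [_ _ _ _ [gP _]] := gh; apply: gP.
have {r_rep} [v /mem_orbit_lists[w0 w0b vw0] vE] := class_facet r_rep c_ge0 valid' FF'.
(* The reduction identified only the image of [F] under a symmetry; as the lists are whole orbits,
   [F] itself is listed. *)
have : cut_orbit (face_by P (@lform R w0)) (h @` F).
  by rewrite (base_orbit w0b) hF vE; exists v.
move=> /cut_orbit_eq orbE.
have : cut_orbit (h @` F) F.
  exists g; first exact: gS.
  have [_ _ _ hK _] := gh; rewrite image_comp.
  have -> : g \o h = id by apply/funext => x; apply: hK.
  exact: image_id.
rewrite orbE (base_orbit w0b) => -[v' v'w0 <-]; exists v'; last exact: erefl.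
exact: orbit_listsI w0b v'w0.
Qed.

Definition base_orbits (i : nat) : set (set RE) := @faces_of R (orbit_list (nth [::] bases i)).

Lemma base_orbits_card i : (i < 4)%N ->
  base_orbits i #= `I_(nth 0%N [:: 30; 192; 320; 3072]%N i).
Proof.
move=> i4; rewrite -(size_orbit_list i4).
have wb : nth [::] bases i \in bases by apply: mem_nth.
have [_ all_uniq _] := orbit_lists_facts.
apply: faces_of_card => [|v]; last exact: (orbit_listsI wb).
exact: (uniq_flatten_mem all_uniq (mem_orbit_lists_base wb)).
Qed.

(** The four orbits are told apart by their sizes. *)
Lemma base_orbits_inj : {in `I_4 &, injective base_orbits}.
Proof.
move=> i j; rewrite !inE /= => i4 j4 ij.
have := base_orbits_card i4; rewrite ij => /card_esym/card_eq_trans.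
move=> /(_ _ _ (base_orbits_card j4))/card_eq_II.
by case: i i4 {ij} => [|[|[|[|i]]]] // _; case: j j4 => [|[|[|[|j]]]].
Qed.

Lemma facet_orbitsE : facet_orbits petersen R = base_orbits @` `I_4.
Proof.
have orbitE w : w \in bases -> facet_orbits petersen R (@faces_of R (orbit_list w)).
  move=> wb; exists (face_by P (@lform R w)); last exact: base_orbit.
  by have [] := base_facet R wb.
apply/seteqP; split=> [_ [F FF <-]|_ [i i4 <-]]; last by apply/orbitE/mem_nth.
move: FF; rewrite facetsE => -[v /mem_orbit_lists[w wb vw] <-].
exists (index w bases); first by have := wb; rewrite -index_mem.
rewrite /base_orbits nth_index; last exact: wb.
rewrite -(base_orbit wb); apply/esym/cut_orbit_eq.
by rewrite (base_orbit wb) {wb}; exists v.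
Qed.

End FacetCount.

(** * Edge and cycle facets *)

Fixpoint simple_paths (n : nat) : seq (seq nat) :=
  if n is n'.+1 then
    flatten [seq [seq v :: l | v <- iota 0 10 &
                    (v \notin l) && (if l is y :: _ then adjn v y else true)]
            | l <- simple_paths n']
  else [:: [::]].

Definition closed_paths (n : nat) : seq (seq nat) :=
  [seq l <- simple_paths n | adjn (last 0%N l) (head 0%N l)].

Definition cycle_bits_of (l : seq nat) : seq bool :=
  [seq has (fun a => is_pair a (next l a) (edgep i)) l | i <- iota 0 15].

(** A cycle of length [n] arises from 2n closed paths, by choice of start and direction; passing to
    edge sets and removing repetitions leaves it once. *)
Definition cycle_list (n : nat) : seq (seq bool) :=
  dedupe (fun k l => k == l) [seq cycle_bits_of l | l <- closed_paths n].

Fixpoint sub_bits (k : seq bool) : seq (seq bool) :=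
  if k is b :: k' then
    let S := sub_bits k' in
    [seq false :: s | s <- S] ++ (if b then [seq true :: s | s <- S] else [::])
  else [:: [::]].

(* The form |F| - 1 - (sum_{e in F} x_e - sum_{e in C - F} x_e). *)
Definition cycle_form (C F : seq bool) : seq Z :=
  rcons [seq (if cf.2 then -1 else if cf.1 then 1 else 0)%Z | cf <- zip C F]
        (dotz (map zbit F) (nseq 15 1) - 1)%Z.

Definition cycle_forms (n : nat) : seq (seq Z) :=
  flatten [seq [seq cycle_form C F | F <- sub_bits C & odd (count id F)] | C <- cycle_list n].

(** Besides counting the cycles, the two inclusions show that the integral forms of the cycle
    inequalities are exactly those of an orbit list, so the two families of facets agree form by
    form. *)
Definition cycle_check (n m : nat) (D : seq (seq Z)) : bool :=
  let L := cycle_list n in let W := cycle_forms n in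
  [&& size L == m, uniq L, all (fun C : seq bool => size C == 15) L,
      all (fun v => has (eqzs v) D) W & all (fun v => has (eqzs v) W) D].

Lemma cycle_checks :
  cycle_check 5 12 (orbit_list w_pent) && cycle_check 6 10 (orbit_list w_hex).
Proof. by vm_compute. Qed.

Definition edge_orbit_check (D : seq (seq Z)) : bool :=
  let L := flatten [seq [:: edge_form false j; edge_form true j] | j <- iota 0 15] in
  all (fun v => has (eqzs v) L) D.

Lemma edge_orbit_checked : edge_orbit_check (orbit_list w_edge).
Proof. by vm_compute. Qed.

Lemma mem_simple_paths n l : l \in simple_paths n ->
  [/\ size l = n, all (fun a => a < 10)%N l, uniq l & sorted adjn l].
Proof.
elim: n l => [|n IH] l; first by rewrite inE => /eqP ->.
rewrite -[simple_paths n.+1]/(flatten _) => /flattenP[_ /mapP[p /IH[<- p10 p_uniq p_path] ->] /mapP[v + ->]].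
rewrite mem_filter mem_iota => /andP[/andP[vp vh] v10].
by split; rewrite //= ?vp ?p10 ?andbT //; case: (p) p_path vh => //= a p' -> ->.
Qed.

Lemma simple_paths_complete l :
  all (fun a => a < 10)%N l -> uniq l -> sorted adjn l -> l \in simple_paths (size l).
Proof.
elim: l => [|v p IH]; first by [].
move=> /andP[v10 p10] /andP[vp p_uniq] vpath; rewrite -[simple_paths _]/(flatten _).
apply/flattenP; eexists; first by apply: map_f; apply: IH => //; apply: path_sorted vpath.
apply: (map_f (cons^~ p)); rewrite mem_filter mem_iota vp v10 andbT.
by case: (p) vpath => //= a p' /andP[->].
Qed.

Lemma closed_pathsP n l : (0 < n)%N ->
  l \in closed_paths n <-> [/\ size l = n, all (fun a => a < 10)%N l, uniq l & cycle adjn l].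
Proof.
move=> n_gt0.
have cycleE a p : cycle adjn (a :: p) = sorted adjn (a :: p) && adjn (last 0%N (a :: p)) a.
  by rewrite /= rcons_path.
rewrite mem_filter; split=> [/andP[ends_adj /mem_simple_paths[l_n l10 l_uniq l_path]]|].
  split=> //; case: l ends_adj l_n l10 l_uniq l_path => [|a p] ends_adj ln _ _ l_path.
    by rewrite -ln in n_gt0.
  by rewrite cycleE l_path ends_adj.
case; case: l => [n0|a p ln l10 l_uniq]; first by rewrite -n0 in n_gt0.
rewrite cycleE => /andP[l_path ends_adj]; rewrite ends_adj -ln.
exact: simple_paths_complete.
Qed.

Definition edge_set (k : seq bool) : {set edge petersen} := [set e | nth false k (ei e)]%SET.

Definition set_bits (A : {set edge petersen}) : seq bool :=
  [seq ed (inord i) \in A | i <- iota 0 15].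

Lemma nth_set_bits A (i : 'I_15) : nth false (set_bits A) i = (ed i \in A).
Proof.
rewrite (nth_map 0%N); last by rewrite size_iota.
by rewrite nth_iota ?add0n ?inord_val.
Qed.

Lemma size_set_bits A : size (set_bits A) = 15%N.
Proof. by rewrite size_map size_iota. Qed.

Lemma set_bitsK : cancel set_bits edge_set.
Proof. by move=> A; apply/setP => e; rewrite inE nth_set_bits eiK. Qed.

Lemma edge_setK k : size k = 15%N -> set_bits (edge_set k) = k.
Proof.
move=> k15; apply: (@eq_from_nth _ false) => [|i]; first by rewrite size_set_bits k15.
rewrite size_set_bits => i15; rewrite (nth_set_bits _ (Ordinal i15)) inE edK.
exact: erefl.
Qed.

Lemma set2_vertex a b c d : a != b -> (a < 10)%N -> (b < 10)%N -> (c < 10)%N -> (d < 10)%N ->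
  ([set vertex a; vertex b] == [set vertex c; vertex d])%SET = is_pair c d (a, b).
Proof.
move=> ab a10 b10 c10 d10; apply/eqP/idP => [/setP eq|/orP[]/eqP[-> ->] //]; last first.
  by rewrite finset.setUC.
have := eq (vertex a); have := eq (vertex b).
rewrite !inE !vertex_eq // !eqxx orbT /is_pair !xpair_eqE.
move=> /esym/orP[/eqP bc|/eqP bd] /esym/orP[/eqP ac|/eqP ad].
- by rewrite ac bc eqxx in ab.
- by rewrite ad bc !eqxx orbT.
- by rewrite ac bd !eqxx.
- by rewrite ad bd eqxx in ab.
Qed.

Lemma set_bits_cycle_edges (c : seq petersen_vertex) : uniq c ->
  set_bits (cycle_edges petersen c) = cycle_bits_of (map vertex_index c).
Proof.
move=> c_uniq.
apply: (@eq_from_nth _ false) => [|i]; first by rewrite size_set_bits size_map size_iota.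
rewrite size_set_bits => i15; rewrite (nth_set_bits _ (Ordinal i15)) inE.
rewrite (nth_map 0%N); last by rewrite size_iota.
rewrite nth_iota; last exact: i15.
rewrite add0n has_map; have [a10 b10 ab] := edgepP i15.
have a_neq_b : (edgep i).1 != (edgep i).2.
  by apply: contraTneq ab => ->; rewrite -adjn_vertex // adj_irr.
have pairE x : (val (ed (Ordinal i15)) == [set x; next c x]%SET) =
    is_pair (vertex_index x) (next (map vertex_index c) (vertex_index x)) (edgep i).
  rewrite val_ed next_map //; last exact: can_inj vertex_indexK.
  have -> : [set x; next c x]%SET =
      [set vertex (vertex_index x); vertex (vertex_index (next c x))]%SET.
    by rewrite !vertex_indexK.
  by rewrite set2_vertex ?vertex_index_lt.
apply/existsP/hasP => [[x /andP[xc xE]]|[x xc xE]]; exists x; rewrite //= -?pairE //.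
by rewrite xc pairE.
Qed.

Lemma cyclesP n C : (2 < n)%N -> (C \in cycles petersen n) = (set_bits C \in cycle_list n).
Proof.
move=> n2; have n0 : (0 < n)%N by case: n n2.
rewrite mem_dedupe // inE /is_cycle n2 /=.
apply/existsP/mapP => [[c /andP[/andP[c_cycle c_uniq] /eqP ->]]|[l]].
  exists (map vertex_index c); last by rewrite set_bits_cycle_edges.
  apply/closed_pathsP => //; split.
  - by rewrite size_map size_tuple.
  - by apply/allP => _ /mapP[x _ ->]; apply: vertex_index_lt.
  - by rewrite map_inj_uniq //; apply: can_inj vertex_indexK.
  - by rewrite cycle_map -(eq_cycle petersen_adjE).
case/(closed_pathsP _ n0)=> l_n l10 l_uniq l_cycle CE.
have l_map : l = map vertex_index (map vertex l).
  rewrite -map_comp map_id_in // => a al /=; rewrite vertexK //.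
  exact: (allP l10).
have c_uniq : uniq (map vertex l).
  by move: l_uniq; rewrite {1}l_map => /map_uniq.
have c_n : size (map vertex l) == n by rewrite size_map l_n.
exists (Tuple c_n); rewrite /ucycleb /= c_uniq andbT; apply/andP; split.
  by rewrite (eq_cycle petersen_adjE) -cycle_map -l_map.
by rewrite -(can_eq set_bitsK) set_bits_cycle_edges // -l_map CE.
Qed.

Lemma card_cycles n m D : (2 < n)%N -> cycle_check n m D -> #|cycles petersen n| = m.
Proof.
move=> n2 /and5P[/eqP <- L_uniq /allP L15 _ _].
rewrite cardE -(size_map set_bits); apply: perm_size; apply: uniq_perm => //.
  by rewrite map_inj_uniq ?enum_uniq //; apply: can_inj set_bitsK.
move=> k; apply/mapP/idP => [[C]|]; first by rewrite mem_enum cyclesP // => ? ->.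
move=> kL; have k15 := eqP (L15 k kL).
by exists (edge_set k); rewrite ?mem_enum ?cyclesP ?edge_setK.
Qed.

Lemma sub_bitsP k s : s \in sub_bits k <->
  size s = size k /\ forall i, nth false s i -> nth false k i.
Proof.
elim: k s => [|b k IH] s /=.
  rewrite inE; split=> [/eqP -> //|[/size0nil -> //]].
rewrite mem_cat; split=> [/orP[/mapP[t /IH[st tk] ->]|]|].
- split=> [|[|i]]; first by rewrite /= st.
    by [].
  by move=> ti; apply: (tk i).
- case: b => // /mapP[t /IH[st tk] ->].
  split=> [|[|i]]; first by rewrite /= st.
    by [].
  by move=> ti; apply: (tk i).
- case: s => [[]//|c s /= [[st] sk]].
  have sS : s \in sub_bits k by apply/IH; split=> // i; apply: (sk i.+1).
  have := sk 0%N; case: c {sk} => /= [->//|_].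
    by rewrite map_f ?orbT.
  by rewrite map_f.
Qed.

Section EdgeAndCycleFacets.
Variable R : realFieldType.
Local Notation RE := {ffun edge petersen -> R^o}.
Local Notation P := (cutp petersen R).

Lemma defines_orbit_facet v : v \in flatten orbit_lists -> defines_facet P (@lform R v).
Proof. by move=> vo; split; have [] := orbit_facet R vo. Qed.

Lemma edge_facetsE : edge_facets petersen R = @faces_of R (orbit_list w_edge).
Proof.
have formE b (j : 'I_15) : (fun x : RE => if b then 1 - x (ed j) else x (ed j)) =
    @lform R (edge_form b j).
  by apply/funext => x; rewrite lform_edge_form.
apply/seteqP; split=> [F [f [fI _ ->]]|F [v v_edge <-]].
  have [b [j ->]] : exists b (j : 'I_15), f = @lform R (edge_form b j).
    case: fI => e; have [j ->] := ed_surj e; case=> ->.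
      by exists false, j; rewrite -formE.
    by exists true, j; rewrite -formE.
  exists (edge_form b j); last exact: erefl.
  exact: edge_form_orbit.
exists (@lform R v); split; last exact: erefl; last first.
  exact: (defines_orbit_facet (orbit_listsI w_edge_base v_edge)).
have := allP edge_orbit_checked v v_edge; rewrite has_eqzs => /flattenP[_ /mapP[j + ->]].
rewrite mem_iota add0n => /andP[_ j15]; rewrite !inE => /orP[]/eqP ->.
  by exists (ed (Ordinal j15)); left; rewrite -(formE false (Ordinal j15)).
by exists (ed (Ordinal j15)); right; rewrite -(formE true (Ordinal j15)).
Qed.

Lemma count_set_bits A : count id (set_bits A) = #|A|.
Proof.
rewrite count_map -sum1_card (reindex ed); last exact: onW_bij ed_bij.
rewrite -sum1_count -[iota 0 15]/(index_iota 0 15) big_mkord.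
by apply: eq_bigl => i; rewrite /= inord_val.
Qed.

Lemma lform_cycle_form (C F : {set edge petersen}) (x : RE) : F \subset C ->
  @lform R (cycle_form (set_bits C) (set_bits F)) x =
  #|F|%:R - 1 - (\sum_(e in F) x e - \sum_(e in (C :\: F)%SET) x e).
Proof.
move=> FC; have C15 := size_set_bits C; have F15 := size_set_bits F.
have nthC := nth_set_bits C; have nthF := nth_set_bits F.
move: (set_bits C) (set_bits F) C15 F15 nthC nthF => k s k15 s15 nthC nthF.
have size_z : size (zip k s) = 15%N by rewrite size_zip k15 s15.
have cardF : #|F|%:R = \sum_(i < 15) (ed i \in F)%:R :> R.
  by rewrite -sum1_card natr_sum big_mkcond sum_ed; apply: eq_bigr => i _; case: ifP.
rewrite lformE addrC; congr (_ + _).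
  rewrite nth_rcons size_map size_z ltnn eqxx zrB zr1; congr (_ - _).
  rewrite -(@dotz_sum _ 15) ?size_map ?s15 // cardF.
  apply: eq_bigr => i _; rewrite (nth_map false) ?s15 // nthF nth_nseq ltn_ord.
  by rewrite [X in _ * X]zr1 mulr1; case: (ed i \in F).
rewrite !(big_mkcond (fun e => e \in _)) /= !sum_ed opprB -sumrB.
apply: eq_bigr => i _; rewrite nth_rcons size_map size_z ltn_ord.
rewrite (nth_map (false, false)) ?size_z // nth_zip ?k15 ?s15 // nthC nthF inE.
case: (boolP (ed i \in F)) => iF /=.
  by rewrite -[(-1)%Z]/(Z.opp 1) zrN zr1 mulN1r sub0r.
by case: (ed i \in C); rewrite ?[zr _ _]zr1 ?[zr _ _]zr0 ?mul1r ?mul0r subr0.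
Qed.

Lemma cycle_facetsE n m w : (2 < n)%N -> w \in bases -> cycle_check n m (orbit_list w) ->
  cycle_facets petersen R n = @faces_of R (orbit_list w).
Proof.
move=> n2 wb /and5P[_ _ /allP L15 /allP forms_orbit /allP orbit_forms].
apply/seteqP; split=> [F [C C_cycle [_ [[A [AC A_odd ->]] _ ->]]]|F [v vw <-]].
  exists (cycle_form (set_bits C) (set_bits A)) => /=; last first.
    by congr face_by; apply/funext => x; rewrite lform_cycle_form.
  rewrite -has_eqzs; apply: forms_orbit; apply/flattenP.
  exists [seq cycle_form (set_bits C) F | F <- sub_bits (set_bits C) & odd (count id F)].
    by apply: (map_f (fun C => [seq cycle_form C F | F <- sub_bits C & odd (count id F)]));
      rewrite -cyclesP.
  apply: map_f; rewrite mem_filter count_set_bits A_odd; apply/sub_bitsP.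
  split=> [|i]; first by rewrite !size_set_bits.
  have [i15|i15] := ltnP i 15; last by rewrite nth_default ?size_set_bits.
  by rewrite !(nth_set_bits _ (Ordinal i15)); apply: (fintype.subsetP AC).
have := orbit_forms v vw; rewrite has_eqzs => /flattenP[_ /mapP[k kL ->]] /mapP[s].
rewrite mem_filter => /andP[s_odd /sub_bitsP[sk s_sub]] vE.
have k15 := eqP (L15 k kL).
have kE := edge_setK k15; have sE : set_bits (edge_set s) = s by rewrite edge_setK ?sk.
exists (edge_set k); first by rewrite cyclesP ?kE.
exists (@lform R v); split; last exact: erefl; last exact: (defines_orbit_facet (orbit_listsI wb vw)).
have sub : edge_set s \subset edge_set k.
  by apply/fintype.subsetP => e; rewrite !inE; apply: s_sub.
exists (edge_set s); split; first exact: sub.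
  by rewrite -count_set_bits sE.
by apply/funext => x; rewrite -(lform_cycle_form _ sub) kE sE vE.
Qed.

End EdgeAndCycleFacets.

Lemma facet_check_tight (R : realFieldType) w tight dual i : facet_check w tight dual ->
  (i < 15)%N -> @lform R w (tight_point R tight i) = 0.
Proof.
case/and5P=> _ _ tight0 /eqP size_t /and4P[_ _ /eqP w16 _] i15.
rewrite size_map in size_t; rewrite lform_tight_point ?size_t //; apply/eqP.
by rewrite zr_eq0; apply: (allP tight0); rewrite mem_nth // size_map size_t.
Qed.

(** * The explicit inequality, its simplices, and the final count *)

Section PetersenForm.
Variable R : realFieldType.
Local Notation RE := {ffun edge petersen -> R^o}.
Local Notation P := (cutp petersen R).
Local Notation delta := (cut_vector petersen R).

Lemma edge_coord_vertex (x : RE) a b i : (i < 15)%N -> is_pair a b (edgep i) ->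
  edge_coord x (vertex a) (vertex b) = x (ed (inord i)).
Proof.
move=> i15 ab; have -> : inord i = Ordinal i15 :> 'I_15.
  by apply: val_inj; rewrite /= inordK.
rewrite /edge_coord -[x (ed _)]/(oapp x 0 (Some (ed (Ordinal i15)))); congr oapp.
rewrite -[RHS]valK val_ed; congr insub.
by case/orP: ab => /eqP; rewrite -[nat_of_ord (Ordinal _)]/i => -> //=; rewrite finset.setUC.
Qed.

Lemma inlE (i : 'I_5) : inl i = vertex i.
Proof. by rewrite -[LHS]vertex_indexK. Qed.

Lemma inrE (i : 'I_5) : inr i = vertex (5 + i).
Proof. by rewrite -[LHS]vertex_indexK. Qed.

Lemma petersen_formE : @petersen_form R = @lform R w_simp.
Proof.
apply/funext => x; rewrite lformE /petersen_form.
pose y k := x (ed (inord k)).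
under [in RHS]eq_bigr => i _ do rewrite -[in x _](inord_val i) -/(y i).
have spoke (i : 'I_5) : edge_coord x (inl i) (inr i) = y (10 + i)%N.
  by rewrite inlE inrE; apply: edge_coord_vertex; case: i => [[|[|[|[|[|]]]]]].
rewrite (eq_bigr (fun i : 'I_5 => y (10 + i)%N) (fun i _ => spoke i)).
(* The third number is the position of the edge in [pairs], whose ends may be listed there in either
   order. *)
have coord a b i : (i < 15)%N -> is_pair a b (edgep i) ->
  edge_coord x (vertex a) (vertex b) = y i by apply: edge_coord_vertex.
rewrite !inlE !inrE (@coord 0 1 0)%N // (@coord 1 2 1)%N // (@coord 2 3 2)%N //.
rewrite (@coord 3 4 3)%N // (@coord 0 4 4)%N // (@coord 8 6 6)%N // (@coord 9 7 8)%N //.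
rewrite (@coord 7 5 9)%N // (@coord 5 8 5)%N // (@coord 6 9 7)%N //.
rewrite !big_ord_recl !big_ord0 /= /bump /=.
have [z0 z1] := (zr0 R, zr1 R); have z2 : zr R 2 = 2 by [].
have zN1 : zr R (-1) = -1 by rewrite -z1 -zrN.
rewrite z0 z1 z2 zN1; ring.
Qed.

(** The face is the hull of its tight cuts, and by [simplex_check] these are the certified affinely
    independent points. *)
Lemma simplex_base : is_simplex (face_by P (@lform R w_simp)).
Proof.
have /and4P[_ _ _ check] := facet_checks.
case: (facet_checkP R check) => ge0 _ _ indep.
have {check} tight0 i (i15 : (i < 15)%N) := facet_check_tight R check i15.
exists 15%N, (fun i : 'I_15 => tight_point R tight_simp i).
split; first exact: indep.
rewrite /lform face_conv_hull => [|_ [S _ <-]]; last by apply/ge0/delta_cutp.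
congr conv_hull; apply/seteqP; split=> [_ [[S _ <-] tight]|_ [i _ <-]]; last first.
  by split; [exists (set_of (cut_index (nth 0%N tight_simp i)))|apply: tight0].
have [u u9 uE] := delta_set_of R S; rewrite uE; move: tight.
rewrite uE /= [LHS]lform_cut // => /eqP; rewrite zr_eq0 => u_tight.
have /mapP[k kt ku] := implyP (allP simplex_check _ (map_f cutbits u9)) u_tight.
have lt : (index k tight_simp < 15)%N by rewrite -[15%N]/(size tight_simp) index_mem.
exists (Ordinal lt) => //; rewrite /tight_point nth_index //.
(* The check compares cuts and not vertex sets, which suffices since the cut vector depends only on
   the cut. *)
apply/ffunP => e; rewrite -[e]eiK !ffunE !crosses_set_of.
by rewrite ku.
Qed.

Lemma facet_orbits_set : facet_orbits petersen R =
  [set @base_orbits R 0; @base_orbits R 1; @base_orbits R 2; @base_orbits R 3].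
Proof.
rewrite facet_orbitsE; move: (@base_orbits R) => O; apply/seteqP.
split=> [_ [i i4 <-]|F [[[->|->]|->]|->]]; [|by exists 0%N|by exists 1%N|by exists 2%N|by exists 3%N].
case: i i4 => [|[|[|[|]]]] // _; last by right.
- by left; left; left.
- by left; left; right.
- by left; right.
Qed.

Lemma facets_card : facets P #= `I_3614.
Proof.
rewrite facetsE; case: orbit_lists_facts => sizes all_uniq _.
have -> : 3614%N = size (flatten orbit_lists).
  by rewrite size_flatten /shape; move: (map _ _) sizes => _ ->.
exact: (faces_of_card R all_uniq).
Qed.

End PetersenForm.

Theorem proposition4 (R : realFieldType) :
  let P := cutp petersen R in
  let O1 := edge_facets petersen R in
  let O2 := cycle_facets petersen R 5 in
  let O3 := cycle_facets petersen R 6 in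
  let O4 := cut_orbit (face_by P (@petersen_form R)) in
  [/\ facets P #= `I_3614,
      facet_orbits petersen R #= `I_4 /\
        facet_orbits petersen R = [set O1; O2; O3; O4],
      [/\ O1 #= `I_(2 * #|{: edge petersen}|) &
          (2 * #|{: edge petersen}| = 30)%N],
      [/\ #|cycles petersen 5| = 12%N, O2 #= `I_(2 ^ 4 * 12) &
          (2 ^ 4 * 12 = 192)%N] /\
      [/\ #|cycles petersen 6| = 10%N, O3 #= `I_(2 ^ 5 * 10) &
          (2 ^ 5 * 10 = 320)%N] &
      [/\ defines_facet P (@petersen_form R), O4 #= `I_(2 ^ 10 * 3),
          (2 ^ 10 * 3 = 3072)%N & forall F, O4 F -> is_simplex F]].
Proof.
have pent_base : w_pent \in bases by [].
have hex_base : w_hex \in bases by [].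
have simp_base : w_simp \in bases by [].
have /andP[check5 check6] := cycle_checks.
move=> P O1 O2 O3 O4.
have O1E : O1 = @base_orbits R 0 by apply: edge_facetsE.
have O2E : O2 = @base_orbits R 1 by exact: (cycle_facetsE R (isT : 2 < 5)%N pent_base check5).
have O3E : O3 = @base_orbits R 2 by exact: (cycle_facetsE R (isT : 2 < 6)%N hex_base check6).
have O4E : O4 = @base_orbits R 3 by rewrite /O4 petersen_formE; apply: (base_orbit R simp_base).
have card5 := card_cycles (isT : 2 < 5)%N check5.
have {check5 check6 pent_base hex_base} card6 := card_cycles (isT : 2 < 6)%N check6.
have {simp_base} [simp_ge0 simp_facet] := base_facet R simp_base.
have edges := card_petersen_edge.
split.
- exact: facets_card.
- split; last by rewrite facet_orbits_set O1E O2E O3E O4E.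
  by rewrite facet_orbitsE; apply: inj_card_eq; apply: base_orbits_inj.
- by rewrite edges O1E; split; [exact: base_orbits_card|].
- split; split; [exact: card5|by rewrite O2E; exact: base_orbits_card|by []
                |exact: card6|by rewrite O3E; exact: base_orbits_card|by []].
- split; [|by rewrite O4E; exact: base_orbits_card|by []|].
    by rewrite petersen_formE; split; [exact: simp_ge0|exact: simp_facet].
  move=> F; rewrite /O4 petersen_formE => -[g gS <-].
  have [h hS gh] := cut_symmetry_iso gS.
  exact: is_simplex_image gh _ (simplex_base R).
Qed.
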